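(* Let $\phi:\mathbb{N}\to\mathbb{N}$ be weakly order-preserving, let $\lambda,\mu$ be partitions with $n$ parts such that $\phi(\lambda)=\mu$, and for $\eta\in S_\mu$ let $G_\eta=\sum_{\zeta\in S_\lambda:\ \phi(\zeta)=\eta}F_\zeta(\mathbf{x};1,t)$. Then for all $\eta\in S_\mu$, at $q=1$, \[ \frac{G_\eta}{P_\lambda(\mathbf{x};1,t)}=\frac{G_\eta}{\sum_{\theta\in S_\mu}G_\theta}=\frac{F_\eta(\mathbf{x};1,t)}{\sum_{\theta\in S_\mu}F_\theta(\mathbf{x};1,t)}=\frac{F_\eta(\mathbf{x};1,t)}{P_\mu(\mathbf{x};1,t)}. \]
   Context: $\phi$ is weakly order-preserving if $\phi(i)\le\phi(j)$ whenever $i\le j$; $\phi(\rho)=(\phi(\rho_1),\dots,\phi(\rho_n))$. $S_\lambda$ is the set of compositions rearranging $\lambda$; $s_i\eta$ swaps entries $i,i+1$. Operators: for $f\in\mathbb{Q}(q,t)[x_1,\dots,x_n]$, $s_if$ swaps $x_i,x_{i+1}$; $L_if=\frac{tx_i-x_{i+1}}{x_i-x_{i+1}}(f-s_if)$; $T_if=tf-L_if$; $T_i^{-1}f=t^{-1}f-t^{-1}L_if$; $(\omega f)(x_1,\dots,x_n)=f(qx_n,x_1,\dots,x_{n-1})$; $Y_i=t^{-(i-1)}T_i^{-1}\cdots T_{n-1}^{-1}\omega T_1\cdots T_{i-1}$. For a composition $\eta$, $y_i(\eta)=q^{\eta_i}t^{-\#\{j>i:\eta_j\ge\eta_i\}-\#\{j<i:\eta_j>\eta_i\}}$.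 With $\eta^+$ the decreasing rearrangement, $\eta\le\nu$ means $\eta^+\le\nu^+$ in dominance order, or $\eta^+=\nu^+$ and $\eta_1+\dots+\eta_i\le\nu_1+\dots+\nu_i$ for all $i$. $E_\eta(\mathbf{x};q,t)$ is the unique polynomial $\sum_{\zeta\le\eta}v_{\eta,\zeta}\mathbf{x}^\zeta$ with $v_{\eta,\eta}=1$ and $Y_iE_\eta=y_i(\eta)E_\eta$ for all $i$. ASEP polynomials: for a partition $\lambda$, $\{F_\eta(\mathbf{x};q,t)\}_{\eta\in S_\lambda}$ is the unique family of homogeneous degree-$|\lambda|$ polynomials with coefficients in $\mathbb{Q}(q,t)$ such that $F_\lambda=E_\lambda$ and: $T_iF_\eta=F_{s_i\eta}$ when $\eta_i>\eta_{i+1}$; $T_iF_\eta=tF_\eta$ when $\eta_i=\eta_{i+1}$; $q^{\eta_n}F_\eta(x_1,\dots,x_n)=F_{(\eta_n,\eta_1,\dots,\eta_{n-1})}(qx_n,x_1,\dots,x_{n-1})$. The Macdonald polynomial is $P_\lambda(\mathbf{x};q,t)=\sum_{\eta\in S_\lambda}F_\eta(\mathbf{x};q,t)$. *)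

(* Defs.v *)
From HB Require Import structures.
From mathcomp Require Import all_boot all_order all_fingroup all_algebra.
From mathcomp Require Import generic_quotient fraction.
From mathcomp Require Import mpoly.

Set Implicit Arguments.
Unset Strict Implicit.
Unset Printing Implicit Defensive.

Import GRing.Theory.
Local Open Scope ring_scope.

(* Conventions: there are n.+1 variables.  Positions are 0-based ordinals     *)
(* i : 'I_n.+1, and i : 'I_n indexes the adjacent pair of positions (i, i+1). *)
(* A composition is a multinomial 'X_{1..n.+1} (zero parts allowed), and x^m  *)
(* is 'X_[m].                                                                 *)

Section Compositions.
Variable n : nat.
Implicit Types (eta nu lam : 'X_{1..n.+1}).

Definition lpos (i : 'I_n) : 'I_n.+1 := widen_ord (leqnSn n) i.
Definition rpos (i : 'I_n) : 'I_n.+1 := lift ord0 i.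

Definition is_partition lam : bool := sorted geq lam.

Definition decr eta : seq nat := sort geq eta.

Definition rearr lam : seq 'X_{1..n.+1} :=
  undup [seq [multinom lam (s i) | i < n.+1] | s : 'S_n.+1].

Definition swap_comp (i : 'I_n) eta : 'X_{1..n.+1} :=
  [multinom eta (tperm (lpos i) (rpos i) k) | k < n.+1].

(* (eta_1, ..., eta_n) |-> (eta_n, eta_1, ..., eta_(n-1)):
   ord_pred is the cyclic predecessor. *)
Definition rot_comp eta : 'X_{1..n.+1} :=
  [multinom eta (ord_pred k) | k < n.+1].

Definition map_parts (phi : nat -> nat) eta : 'X_{1..n.+1} :=
  [multinom phi (eta k) | k < n.+1].

Definition psums_le (a b : seq nat) : Prop :=
  forall k : nat, (sumn (take k a) <= sumn (take k b))%N.

Definition dominance (a b : seq nat) : Prop := sumn a = sumn b /\ psums_le a b.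

Definition comp_le eta nu : Prop :=
  dominance (decr eta) (decr nu) \/ (decr eta = decr nu /\ psums_le eta nu).

End Compositions.

Section DividedDifference.
Variables (K : fieldType) (n : nat).
Implicit Types (f : {mpoly K[n.+1]}) (i : 'I_n).

Definition swap_var i f : {mpoly K[n.+1]} := msym (tperm (lpos i) (rpos i)) f.

Lemma swap_var_dvd i f :
  exists g, ('X_(lpos i) - 'X_(rpos i)) * g == f - swap_var i f.
Proof.
rewrite /swap_var; set s := tperm _ _; set d := _ - _.
pose D f := exists g, d * g = f - msym s f.
suff: D f by case=> g <-; exists g.
have D0 c : D c%:MP.
  by exists 0; rewrite mulr0 -[c%:MP]mulr1 mul_mpolyC msymZ msym1 subrr.
have DD p q : D p -> D q -> D (p + q).
  case=> g eg [h eh]; exists (g + h).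
  by rewrite mulrDr eg eh msymD opprD addrACA.
have DM p q : D p -> D q -> D (p * q).
  case=> g eg [h eh]; exists (g * q + msym s p * h).
  rewrite mulrDr mulrA eg mulrCA eh msymM mulrBl mulrBr addrA.
  by rewrite subrK.
have DX (k : 'I_n.+1) : D 'X_k.
  rewrite /D /msym mmapX mmap1U /s; case: tpermP => [->|->|_ _].
  - by exists 1; rewrite mulr1.
  - by exists (-1); rewrite mulrN1 opprB.
  - by exists 0; rewrite mulr0 subrr.
elim/mpolyind: f => [|c m p _ _ Dp]; first by rewrite -(mpolyC0 _ K); apply: D0.
apply: (DD) => //; rewrite -mul_mpolyC; apply: (DM) => //.
rewrite mpolyXE_id; apply: (big_ind D) => [||k _]; [exact: (D0 1)|exact: DM|].
by elim: (m k) => [|e IH]; [exact: (D0 1)|rewrite exprS; apply: DM].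
Qed.

(* (f - s_i f) / (x_i - x_(i+1)) *)
Definition ddiff i f : {mpoly K[n.+1]} := xchoose (swap_var_dvd i f).

End DividedDifference.

Section Hecke.
Variables (K : fieldType) (q t : K) (n : nat).
Implicit Types (f : {mpoly K[n.+1]}) (i : 'I_n) (eta lam : 'X_{1..n.+1}).

Definition opL i f := (t *: 'X_(lpos i) - 'X_(rpos i)) * ddiff i f.
Definition opT i f := t *: f - opL i f.
Definition opTinv i f := t^-1 *: f - t^-1 *: opL i f.

Definition omega f : {mpoly K[n.+1]} :=
  f \mPo [tuple (if k == ord0 then q *: 'X_(ord_max : 'I_n.+1)
                 else 'X_(ord_pred k)) | k < n.+1].

(* enum 'I_n is increasing and foldr applies the last operator of the list
   first; with k = i - 1 this is
   t^(-(i-1)) T_i^-1 ... T_(n-1)^-1 omega T_1 ... T_(i-1) for n variables. *)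
Definition opY (k : 'I_n.+1) f : {mpoly K[n.+1]} :=
  t ^- k *:
    foldr opTinv
      (omega (foldr opT f [seq j : 'I_n <- enum 'I_n | (j < k)%N]))
      [seq j : 'I_n <- enum 'I_n | (k <= j)%N].

Definition eigval (k : 'I_n.+1) eta : K :=
  q ^+ eta k *
  t ^- (#|[set j : 'I_n.+1 | (k < j)%N && (eta k <= eta j)%N]|
        + #|[set j : 'I_n.+1 | (j < k)%N && (eta k < eta j)%N]|).

Definition is_nsMacdonald eta (E : {mpoly K[n.+1]}) : Prop :=
  [/\ forall zeta, zeta \in msupp E -> comp_le zeta eta,
      E@_eta = 1
    & forall k, opY k E = eigval k eta *: E].

(* The values of F outside of rearr lam are irrelevant. *)
Definition is_ASEP lam (F : 'X_{1..n.+1} -> {mpoly K[n.+1]}) : Prop :=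
  is_nsMacdonald lam (F lam) /\
  forall eta, eta \in rearr lam ->
    [/\ F eta \is (mdeg lam).-homog,
        forall i, (eta (lpos i) > eta (rpos i))%N ->
          opT i (F eta) = F (swap_comp i eta),
        forall i, eta (lpos i) = eta (rpos i) -> opT i (F eta) = t *: F eta
      & q ^+ eta ord_max *: F eta = omega (F (rot_comp eta))].

Definition macdonaldP lam (F : 'X_{1..n.+1} -> {mpoly K[n.+1]}) : {mpoly K[n.+1]} :=
  \sum_(eta <- rearr lam) F eta.

End Hecke.

(* Q(q,t) is realised as Q(t)(q). *)
Notation Qt := {fraction {poly rat}}.
Notation Qqt := {fraction {poly {fraction {poly rat}}}}.

Definition qvar : Qqt := FracField.tofrac 'X.
Definition tvar : Qqt := FracField.tofrac (FracField.tofrac 'X)%:P.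

(* repr r need not be a reduced fraction, hence the division by the gcd. *)
Definition rednum (r : Qqt) : {poly Qt} :=
  \n_(repr r) %/ gcdp \n_(repr r) \d_(repr r).
Definition redden (r : Qqt) : {poly Qt} :=
  \d_(repr r) %/ gcdp \n_(repr r) \d_(repr r).

Definition regular_q1 (r : Qqt) : bool := (redden r).[1] != 0.
(* Meaningful only if regular_q1 r; otherwise the value is 0. *)
Definition at_q1 (r : Qqt) : Qt := (rednum r).[1] / (redden r).[1].

Definition mregular_q1 (n : nat) (p : {mpoly Qqt[n]}) : Prop :=
  forall m, regular_q1 p@_m.
Definition mat_q1 (n : nat) (p : {mpoly Qqt[n]}) : {mpoly Qt[n]} :=
  \sum_(m <- msupp p) at_q1 p@_m *: 'X_[m].

Definition mquot (n : nat) (a b : {mpoly Qt[n]}) : {fraction {mpoly Qt[n]}} :=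
  FracField.tofrac a / FracField.tofrac b.

(* Main.v *)
Require Import Defs.
From HB Require Import structures.
From mathcomp Require Import all_boot all_order all_fingroup all_algebra.
From mathcomp Require Import generic_quotient fraction.
From mathcomp Require Import mpoly.
From mathcomp Require Import zify ring.

(* Regularity.  The eigenvectors of the Cherednik operators [Y_i] are built from
   the constant 1 by the intertwiners [T_i + c] and [Phi = x_1 omega^-1].  At
   [q = 1] the eigenvalues attached to a composition are distinct powers of [t],
   so no coefficient [c] has a pole there, and every step is unitriangular for
   the affine length [len].  These eigenvectors span, and the joint spectrum is
   simple for generic [q], so they are the nonsymmetric Macdonald polynomials.

   Lumping.  At [q = 1] the family [G] satisfies the exchange relations of the
   family [F], and both operators [T_i] and [omega] are linear over symmetric
   polynomials, so [D = G P_mu - F P_lam] satisfies them too and sums to zero.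
   Such a family vanishes.  On coefficients of monomials [x^z] of maximal norm
   (the sum of squares of the exponents) in [D_theta], and then of maximal
   discordance between [theta] and [z], exchanging two adjacent columns
   [(theta_i, z_i)] multiplies the coefficient by [1], [t] or [t^-1].  Carrying a
   column once around the circle returns to the same coefficient, so the factors
   cancel, which forces [theta] to be a weakly increasing function of [z]: in
   the coefficient of [x^z] in the sum only one term survives. *)

Set Implicit Arguments.
Unset Strict Implicit.
Unset Printing Implicit Defensive.

Import GRing.Theory.
Local Open Scope ring_scope.

(** * Adjacent positions *)

Section Positions.
Variable n : nat.
Implicit Types (i j : 'I_n) (k : 'I_n.+1).

(** Starting from [F lam], the other members are reached by the [T_i], whose matrix entries on
    monomials are polynomials in [t]; so only the eigenvector [E_lam] could have a pole at [q = 1].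
    It cannot be studied by its spectrum there: at [q = 1] the eigenvalues of every composition are
    the powers of [1/t] with exponents 0 to [n] in some order, so many compositions share a
    spectrum. Hence regularity is carried along a construction over generic [q], and uniqueness is
    invoked only over the large field. In the lumping, [q = 1] enters through the rotation relation:
    the factor [q^(eta_n)] distinguishes parts that [phi] merges, and at [q = 1] it disappears. The
    two gradings of the vanishing argument have distinct tasks. [T_i] applied to [x^z] produces
    [x^z], its swap, and exponents between them, and the latter have smaller norm; at the top norm
    [T_i] thus acts on pairs of monomials. When [theta] and [z] are ordered the same way at [i], one
    unwanted term is left, the coefficient of the swapped [z] in [D_theta]; that pair has larger
    discordance, so it is already known to vanish. *)

Lemma val_lpos i : lpos i = i :> nat. Proof. by []. Qed.
Lemma val_rpos i : rpos i = i.+1 :> nat. Proof. by rewrite /= /bump. Qed.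

Lemma lpos_neq_rpos i : lpos i != rpos i.
Proof. by rewrite -val_eqE /= /bump; lia. Qed.

Definition tpos i : {perm 'I_n.+1} := tperm (lpos i) (rpos i).

Lemma tpos_l i : tpos i (lpos i) = rpos i. Proof. exact: tpermL. Qed.
Lemma tpos_r i : tpos i (rpos i) = lpos i. Proof. exact: tpermR. Qed.
Lemma tpos_D i k : k != lpos i -> k != rpos i -> tpos i k = k.
Proof. by rewrite eq_sym => h1 h2; apply: tpermD => //; rewrite eq_sym. Qed.

End Positions.

(** * Algebra endomorphisms of the polynomial ring *)

Section AlgebraMorphisms.
Variables (K : fieldType) (n : nat).
Local Notation P := {mpoly K[n]}.
Implicit Types f g : P -> P.

Definition alg_endo f : Prop :=
  [/\ {morph f : x y / x + y}, {morph f : x y / x * y} & forall c, f c%:MP = c%:MP].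

Lemma alg_endo_comp f g : alg_endo f -> alg_endo g -> alg_endo (f \o g).
Proof.
move=> [fD fM fC] [gD gM gC]; split=> [x y|x y|c] /=.
- by rewrite gD fD.
- by rewrite gM fM.
- by rewrite gC fC.
Qed.

Lemma eq_alg_endo f g : alg_endo f -> alg_endo g ->
  (forall k, f 'X_k = g 'X_k) -> f =1 g.
Proof.
move=> [fD fM fC] [gD gM gC] fgX p.
have h0 : forall h : P -> P, (forall c, h c%:MP = c%:MP) -> h 0 = 0.
  by move=> h hC; rewrite -{1}mpolyC0 hC mpolyC0.
have h1 : forall h : P -> P, (forall c, h c%:MP = c%:MP) -> h 1 = 1.
  by move=> h hC; rewrite -{1}mpolyC1 hC mpolyC1.
rewrite [p]mpolyE (big_morph _ fD (h0 _ fC)) (big_morph _ gD (h0 _ gC)).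
apply: eq_bigr => m _; rewrite -mul_mpolyC fM gM fC gC; congr (_ * _).
rewrite mpolyXE_id (big_morph _ fM (h1 _ fC)) (big_morph _ gM (h1 _ gC)).
apply: eq_bigr => k _; elim: (m k) => [|e IH]; first by rewrite !expr0 !h1.
by rewrite !exprS fM gM IH fgX.
Qed.

End AlgebraMorphisms.

(** Reduces an equation to two known ones by an explicit linear combination: the coefficients [c1],
    [c2] are the certificate, and the remaining identity is left to [ring]. *)
Lemma lin_comb2 (R : comNzRingType) (a1 b1 a2 b2 c1 c2 x y : R) :
  a1 = b1 -> a2 = b2 -> x - y = c1 * (a1 - b1) + c2 * (a2 - b2) -> x = y.
Proof. by move=> -> -> /eqP; rewrite !subrr !mulr0 addr0 subr_eq0 => /eqP. Qed.

(** * The Hecke generators: linearity, quadratic relation, inverses *)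

Section HeckeRelations.
Variables (K : fieldType) (q t : K) (n : nat).
Implicit Types (f g p : {mpoly K[n.+1]}) (i j : 'I_n) (k : 'I_n.+1).
Local Notation P := {mpoly K[n.+1]}.
Local Notation xl i := ('X_(lpos i) : P).
Local Notation xr i := ('X_(rpos i) : P).
Local Notation T := (opT t).
Local Notation Ti := (opTinv t).
Local Notation tt := (t%:MP : P).

Lemma swap_varE i f : swap_var i f = msym (tpos i) f. Proof. by []. Qed.

Lemma swap_varX i k : swap_var i 'X_k = 'X_(tpos i k) :> P.
Proof. by rewrite /swap_var /msym mmapX mmap1U. Qed.

Lemma swap_varC i c : swap_var i c%:MP = c%:MP :> P.
Proof. by rewrite /swap_var /msym mmapC. Qed.

Lemma swap_var1 i : swap_var i 1 = 1 :> P.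
Proof. exact: msym1. Qed.

Lemma swap_varK i : involutive (@swap_var K n i).
Proof. by move=> f; rewrite /swap_var -msymMm tperm2 msym1m. Qed.

Definition swap_varM i f g : swap_var i (f * g) = swap_var i f * swap_var i g :=
  rmorphM (msym (tpos i)) f g.
Definition swap_varB i f g : swap_var i (f - g) = swap_var i f - swap_var i g :=
  rmorphB (msym (tpos i)) f g.
Definition swap_varD i f g : swap_var i (f + g) = swap_var i f + swap_var i g :=
  rmorphD (msym (tpos i)) f g.

Lemma X_inj : injective (fun k => 'X_k : P).
Proof.
move=> k k' /(congr1 (mcoeff U_(k))); rewrite !mcoeffXU eqxx.
by case: eqP => // _ /eqP; rewrite oner_eq0.
Qed.

Lemma X_sub_neq0 k k' : k != k' -> 'X_k - 'X_k' != 0 :> P.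
Proof. by rewrite subr_eq0 (inj_eq X_inj). Qed.

Lemma xlr_neq0 i : xl i - xr i != 0.
Proof. exact/X_sub_neq0/lpos_neq_rpos. Qed.

Lemma ddiffE i f : (xl i - xr i) * ddiff i f = f - swap_var i f.
Proof. exact/eqP/(xchooseP (swap_var_dvd i f)). Qed.

(* Every Hecke relation below is checked after multiplication by the
   denominator of the divided difference. *)
Lemma opTE i f :
  (xl i - xr i) * T i f = (1 - tt) * xr i * f + (tt * xl i - xr i) * swap_var i f.
Proof.
rewrite /opT /opL mulrBr mulrCA ddiffE -!mul_mpolyC; ring.
Qed.

Lemma opTinvE i f : t != 0 -> Ti i f = t^-1 *: (T i f - (t - 1) *: f).
Proof.
move=> t0; rewrite /opTinv /opT -scalerBr; congr (_ *: _).
by rewrite scalerBl scale1r opprB [RHS]addrC addrA subrK.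
Qed.

Lemma alg_endo_swap i : alg_endo (@swap_var K n i).
Proof.
by split=> [x y|x y|c]; rewrite ?swap_varD ?swap_varM ?swap_varC.
Qed.

#[local] Opaque swap_var opT opTinv.

Lemma opT_uniq i f g :
  (xl i - xr i) * g = (1 - tt) * xr i * f + (tt * xl i - xr i) * swap_var i f ->
  T i f = g.
Proof. by rewrite -opTE => /(mulfI (xlr_neq0 i)) ->. Qed.

Lemma opT_linear i c f g : T i (c *: f + g) = c *: T i f + T i g.
Proof.
apply: opT_uniq; rewrite swap_varD -!mul_mpolyC swap_varM swap_varC.
by rewrite mulrDr opTE mulrCA opTE; ring.
Qed.

Lemma opTD i f g : T i (f + g) = T i f + T i g.
Proof. by rewrite -[f]scale1r opT_linear !scale1r. Qed.

Lemma opT0 i : T i 0 = 0.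
Proof. by apply: opT_uniq; rewrite swap_varE msym0 !mulr0 addr0. Qed.

Lemma opTZ i c f : T i (c *: f) = c *: T i f.
Proof. by rewrite -[c *: f]addr0 opT_linear opT0 addr0. Qed.

Lemma opT_sum i (I : Type) (r : seq I) (Q : pred I) (F : I -> P) :
  T i (\sum_(x <- r | Q x) F x) = \sum_(x <- r | Q x) T i (F x).
Proof. exact: (big_morph _ (opTD i) (opT0 i)). Qed.

Lemma opT1 i : T i 1 = t *: 1.
Proof.
apply: opT_uniq; rewrite swap_varE msym1 -mul_mpolyC; ring.
Qed.

Lemma opT_mul_sym i f g : swap_var i g = g -> T i (f * g) = T i f * g.
Proof.
by move=> sg; apply: opT_uniq; rewrite mulrA opTE swap_varM sg; ring.
Qed.

Lemma opT_swap i f : T i (swap_var i f) = t *: (f + swap_var i f) - T i f.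
Proof.
by apply: opT_uniq; rewrite mulrBr opTE swap_varK -mul_mpolyC; ring.
Qed.

(** The difference [t f - T_i f] is [(t x_i - x_(i+1))] times the divided difference of [f], and the
    first factor is nonzero because its coefficient at [x_(i+1)] is -1. *)
Lemma opT_eq_sym i f : T i f = t *: f -> swap_var i f = f.
Proof.
move=> e; have := opTE i f; rewrite e -mul_mpolyC => /eqP; rewrite -subr_eq0.
have -> : (xl i - xr i) * (tt * f)
   - ((1 - tt) * xr i * f + (tt * xl i - xr i) * swap_var i f)
   = (tt * xl i - xr i) * (f - swap_var i f) by ring.
rewrite mulf_eq0 => /orP[|]; last by rewrite subr_eq0 => /eqP <-.
move/eqP/(congr1 (mcoeff U_(rpos i))).
rewrite mcoeffB mcoeffCM !mcoeffXU eqxx (negPf (lpos_neq_rpos i)).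
by rewrite mulr0 sub0r mcoeff0 => /eqP; rewrite oppr_eq0 oner_eq0.
Qed.

Lemma swap_opT i f :
  (xl i - xr i) * swap_var i (T i f)
  = - ((1 - tt) * xl i * swap_var i f + (tt * xr i - xl i) * f).
Proof.
have := congr1 (swap_var i) (opTE i f).
rewrite !(swap_var1, swap_varM, swap_varB, swap_varD, swap_varC, swap_varX, swap_varK).
by rewrite tpos_l tpos_r => <-; ring.
Qed.

Lemma opT_quadratic i f : T i (T i f) = (t - 1) *: T i f + t *: f.
Proof.
apply: opT_uniq; apply: (mulfI (xlr_neq0 i)).
rewrite -!mul_mpolyC mpolyCB mpolyC1.
apply: (lin_comb2 (c1 := (tt - 1) * xl i) (c2 := - (tt * xl i - xr i))
                  (opTE i f) (swap_opT i f)); ring.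
Qed.


Hypothesis t_neq0 : t != 0.

Lemma opTK i f : Ti i (T i f) = f.
Proof.
rewrite opTinvE // opT_quadratic addrAC subrr add0r scalerA mulVf //.
exact: scale1r.
Qed.

Lemma opTinv_linear i c f g : Ti i (c *: f + g) = c *: Ti i f + Ti i g.
Proof.
rewrite !opTinvE // opT_linear -!mul_mpolyC.
by move: (t^-1)%:MP (t - 1)%:MP c%:MP (T i f) (T i g) => u v w a b; ring.
Qed.

Lemma opTinvK i f : T i (Ti i f) = f.
Proof.
rewrite opTinvE // opTZ opTD -scaleN1r scalerA opTZ opT_quadratic mulN1r.
by rewrite addrAC -scalerDl subrr scale0r add0r scalerA mulVf // scale1r.
Qed.

End HeckeRelations.

(** * Commutation, braid relation and multiplication by variables *)

(** The pattern of [T_i T_j f = T_j T_i f] for distant [i], [j]: [U] is [T_j f], [V] is [T_i f], a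
    suffix marks the image under that swap, and [d], [e] are the two denominators. *)
Lemma commute_identity (R : idomainType)
    (d e p r p' r' f fi fj fij U Ui V Vj L M : R) :
  d != 0 -> e != 0 ->
  d * L = p * U + r * Ui -> e * U = p' * f + r' * fj -> e * Ui = p' * fi + r' * fij ->
  e * M = p' * V + r' * Vj -> d * V = p * f + r * fi -> d * Vj = p * fj + r * fij ->
  L = M.
Proof.
move=> d0 e0 eL eU eUi eM eV eVj; apply: (mulfI (mulf_neq0 d0 e0)).
transitivity (p * (e * U) + r * (e * Ui)); first by rewrite [d * e]mulrC -mulrA eL; ring.
transitivity (p' * (d * V) + r' * (d * Vj)); first by rewrite eU eUi eV eVj; ring.
by rewrite -mulrA eM; ring.
Qed.

(** The braid relation over abstract letters: [x], [y], [z] are the three consecutive variables, [f]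
    to [w] the six permuted copies of the polynomial. [V], [U], [L] stand for [T_i f], [T_j T_i f],
    [T_i T_j T_i f], and [A], [B], [M] for the same with [i] and [j] exchanged; suffixes mark images
    under swaps. After clearing denominators both sides expand in the six copies. *)
Lemma braid_identity (R : idomainType) (x y z t f fi fj fij fji w : R)
    (V Vi Vj Vij U Ui L A Ai Aj Aji B Bj M : R) :
  x - y != 0 -> x - z != 0 -> y - z != 0 ->
  (x - y) * L = (1 - t) * y * U + (t * x - y) * Ui ->
  (y - z) * U = (1 - t) * z * V + (t * y - z) * Vj ->
  (x - z) * Ui = (1 - t) * z * Vi + (t * x - z) * Vij ->
  (x - y) * V = (1 - t) * y * f + (t * x - y) * fi ->
  (x - y) * Vi = - ((1 - t) * x * fi + (t * y - x) * f) ->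
  (x - z) * Vj = (1 - t) * z * fj + (t * x - z) * fji ->
  (y - z) * Vij = (1 - t) * z * fij + (t * y - z) * w ->
  (y - z) * M = (1 - t) * z * B + (t * y - z) * Bj ->
  (x - y) * B = (1 - t) * y * A + (t * x - y) * Ai ->
  (x - z) * Bj = (1 - t) * z * Aj + (t * x - z) * Aji ->
  (y - z) * A = (1 - t) * z * f + (t * y - z) * fj ->
  (y - z) * Aj = - ((1 - t) * y * fj + (t * z - y) * f) ->
  (x - z) * Ai = (1 - t) * z * fi + (t * x - z) * fij ->
  (x - y) * Aji = (1 - t) * y * fji + (t * x - y) * w ->
  L = M.
Proof.
move=> nxy nxz nyz eL eU eUi eV eVi eVj eVij eM eB eBj eA eAj eAi eAji.
have EL : (x - y) ^+ 2 * (x - z) * (y - z) * L =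
    (1 - t) ^+ 2 * y * z * (x - z) * ((1 - t) * y * f + (t * x - y) * fi)
    + (1 - t) * y * (x - y) * (t * y - z) * ((1 - t) * z * fj + (t * x - z) * fji)
    - (t * x - y) * (y - z) * (1 - t) * z * ((1 - t) * x * fi + (t * y - x) * f)
    + (t * x - y) * (x - y) * (t * x - z) * ((1 - t) * z * fij + (t * y - z) * w).
  transitivity ((x - y) * (x - z) * (y - z) * ((x - y) * L)); first by ring.
  rewrite eL.
  transitivity ((1 - t) * y * (x - y) * (x - z) * ((y - z) * U)
     + (t * x - y) * (x - y) * (y - z) * ((x - z) * Ui)); first by ring.
  rewrite eU eUi.
  transitivity ((1 - t) ^+ 2 * y * z * (x - z) * ((x - y) * V)
     + (1 - t) * y * (x - y) * (t * y - z) * ((x - z) * Vj)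
     + (t * x - y) * (y - z) * (1 - t) * z * ((x - y) * Vi)
     + (t * x - y) * (x - y) * (t * x - z) * ((y - z) * Vij)); first by ring.
  by rewrite eV eVi eVj eVij; ring.
have EM : (y - z) ^+ 2 * (x - z) * (x - y) * M =
    (1 - t) ^+ 2 * y * z * (x - z) * ((1 - t) * z * f + (t * y - z) * fj)
    + (1 - t) * z * (y - z) * (t * x - y) * ((1 - t) * z * fi + (t * x - z) * fij)
    - (t * y - z) * (x - y) * (1 - t) * z * ((1 - t) * y * fj + (t * z - y) * f)
    + (t * y - z) * (y - z) * (t * x - z) * ((1 - t) * y * fji + (t * x - y) * w).
  transitivity ((y - z) * (x - z) * (x - y) * ((y - z) * M)); first by ring.
  rewrite eM.
  transitivity ((1 - t) * z * (y - z) * (x - z) * ((x - y) * B)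
     + (t * y - z) * (y - z) * (x - y) * ((x - z) * Bj)); first by ring.
  rewrite eB eBj.
  transitivity ((1 - t) ^+ 2 * y * z * (x - z) * ((y - z) * A)
     + (1 - t) * z * (y - z) * (t * x - y) * ((x - z) * Ai)
     + (t * y - z) * (x - y) * (1 - t) * z * ((y - z) * Aj)
     + (t * y - z) * (y - z) * (t * x - z) * ((x - y) * Aji)); first by ring.
  by rewrite eA eAi eAj eAji; ring.
have n0 : (x - y) ^+ 2 * (x - z) * (y - z) ^+ 2 != 0 by rewrite !mulf_neq0 ?expf_neq0.
apply: (mulfI n0).
transitivity ((y - z) * ((x - y) ^+ 2 * (x - z) * (y - z) * L)); first by ring.
transitivity ((x - y) * ((y - z) ^+ 2 * (x - z) * (x - y) * M)); last by ring.
by rewrite EL EM; ring.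
Qed.

Section HeckeBraid.
Variables (K : fieldType) (t : K) (n : nat).
Implicit Types (f g p : {mpoly K[n.+1]}) (i j : 'I_n) (k : 'I_n.+1).
Local Notation P := {mpoly K[n.+1]}.
Local Notation xl i := ('X_(lpos i) : P).
Local Notation xr i := ('X_(rpos i) : P).
Local Notation T := (opT t).
Local Notation Ti := (opTinv t).
Local Notation tt := (t%:MP : P).

Lemma swap_braid i j f : rpos i = lpos j ->
  swap_var i (swap_var j (swap_var i f)) = swap_var j (swap_var i (swap_var j f)).
Proof.
move=> e; rewrite !swap_varE -!msymMm.
congr (msym _ f); rewrite /tpos -e.
have lr := lpos_neq_rpos i; have lr' := lpos_neq_rpos j.
have l_r : lpos i != rpos j.
  by move/(congr1 val): e; rewrite -val_eqE /= /bump; lia.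
have V (a b : 'I_n.+1) : (tperm a b)^-1%g = tperm a b by rewrite tpermV.
have J (a b c : 'I_n.+1) : a != b -> b != c -> a != c ->
    (tperm a b * tperm b c * tperm a b = tperm a c)%g.
  move=> ab bc ac; rewrite -{1}(V a b) -mulgA -[(_ * (_ * _))%g]/(tperm b c ^ tperm a b)%g.
  by rewrite tpermJ tpermR tpermD // eq_sym.
rewrite !mulgA J //; last by rewrite e.
rewrite [tperm (lpos i) (rpos i)]tpermC [tperm (rpos i) (rpos j)]tpermC.
by rewrite J 1?tpermC // 1?eq_sym // e.
Qed.

#[local] Opaque swap_var opT opTinv.

Lemma swap_opTE i j f :
  ('X_(tpos j (lpos i)) - 'X_(tpos j (rpos i))) * swap_var j (T i f)
  = (1 - tt) * 'X_(tpos j (rpos i)) * swap_var j f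
    + (tt * 'X_(tpos j (lpos i)) - 'X_(tpos j (rpos i))) * swap_var j (swap_var i f).
Proof.
have := congr1 (swap_var j) (opTE t i f).
by rewrite !(swap_var1, swap_varM, swap_varB, swap_varD, swap_varC, swap_varX).
Qed.

Lemma opT_braid i j f : rpos i = lpos j -> T i (T j (T i f)) = T j (T i (T j f)).
Proof.
move=> e; have e' := congr1 val e; rewrite /= /bump /= in e'.
have i_ri : tpos i (rpos j) = rpos j by apply: tpos_D; rewrite -val_eqE /= /bump; lia.
have j_li : tpos j (lpos i) = lpos i by apply: tpos_D; rewrite -val_eqE /= /bump; lia.
have E1 g := opTE t i g; have E2 g := opTE t j g.
have S1 g := swap_opTE i j g; have S2 g := swap_opTE j i g.
rewrite -e in E2 S1 S2.
rewrite j_li {1 2 3}e tpos_l in S1; rewrite i_ri tpos_r in S2.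
apply: (@braid_identity _ (xl i) (xr i) (xr j) tt f (swap_var i f) (swap_var j f)
  (swap_var i (swap_var j f)) (swap_var j (swap_var i f))
  (swap_var i (swap_var j (swap_var i f))) _ (swap_var i (T i f)) (swap_var j (T i f))
  (swap_var i (swap_var j (T i f))) _ (swap_var i (T j (T i f))) _
  _ (swap_var i (T j f)) (swap_var j (T j f)) (swap_var j (swap_var i (T j f)))
  _ (swap_var j (T i (T j f))) _ _ _ _ (E1 _) (E2 _) (S2 _) (E1 _) (swap_opT t i f)
  (S1 _) _ (E2 _) (E1 _) (S1 _) (E2 _) _ (S2 _) _).
- exact: xlr_neq0.
- by apply: X_sub_neq0; rewrite -val_eqE /= /bump; lia.
- by rewrite e; apply: xlr_neq0.
- have := congr1 (swap_var i) (S1 f).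
  rewrite !(swap_var1, swap_varM, swap_varB, swap_varD, swap_varC, swap_varX).
  by rewrite i_ri tpos_l.
- by have h := swap_opT t j f; rewrite -e in h; exact: h.
- have := congr1 (swap_var j) (S2 f).
  rewrite !(swap_var1, swap_varM, swap_varB, swap_varD, swap_varC, swap_varX).
  by rewrite (swap_braid _ e) j_li tpos_r -e => ->.
Qed.

Lemma opT_comm i j f : (i.+1 < j)%N -> T i (T j f) = T j (T i f).
Proof.
move=> ij.
have fix_ij k : (k == lpos j) || (k == rpos j) -> tpos i k = k.
  by case/orP=> /eqP ->; apply: tpos_D; rewrite -val_eqE /= /bump; lia.
have fix_ji k : (k == lpos i) || (k == rpos i) -> tpos j k = k.
  by case/orP=> /eqP ->; apply: tpos_D; rewrite -val_eqE /= /bump; lia.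
have S1 g := swap_opTE i j g; have S2 g := swap_opTE j i g.
have jl : tpos j (lpos i) = lpos i by rewrite fix_ji ?eqxx.
have jr : tpos j (rpos i) = rpos i by rewrite fix_ji ?eqxx ?orbT.
have il : tpos i (lpos j) = lpos j by rewrite fix_ij ?eqxx.
have ir : tpos i (rpos j) = rpos j by rewrite fix_ij ?eqxx ?orbT.
rewrite jl jr in S1; rewrite il ir in S2.
apply: (@commute_identity _ (xl i - xr i) (xl j - xr j) ((1 - tt) * xr i)
  (tt * xl i - xr i) ((1 - tt) * xr j) (tt * xl j - xr j) f _ _
  (swap_var i (swap_var j f)) _ _ _ _ _ _ (xlr_neq0 _ _) (xlr_neq0 _ _)
  (opTE t i _) (opTE t j _) (S2 _) (opTE t j _) (opTE t i _)).
rewrite S1; congr (_ + _ * _); rewrite !swap_varE -!msymMm; congr (msym _ f).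
rewrite [LHS]conjgC; congr (_ * _)%g.
by rewrite tpermJ -!/(tpos _) ?jl ?jr ?il ?ir.
Qed.

(** The cross relation of the affine Hecke algebra, [T_i x_i T_i = t x_(i+1)]; it carries a variable
    through the chains of generators in [Y]. *)
Lemma opT_Xl i f : T i (xl i * T i f) = t *: (xr i * f).
Proof.
apply: opT_uniq; rewrite swap_varM swap_varX tpos_l -!mul_mpolyC.
apply: (mulfI (xlr_neq0 K i)).
apply: (lin_comb2 (c1 := - ((1 - tt) * xr i * xl i)) (c2 := - ((tt * xl i - xr i) * xr i))
                  (opTE t i f) (swap_opT t i f)); ring.
Qed.

Lemma opT_XD i k f : k != lpos i -> k != rpos i -> T i ('X_k * f) = 'X_k * T i f.
Proof.
move=> kl kr; rewrite ![_ * f]mulrC ![_ * T i f]mulrC opT_mul_sym //.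
by rewrite swap_varX tpos_D.
Qed.

End HeckeBraid.

(** * The cyclic shift of the variables and its inverse *)

Section CyclicShift.
Variable n : nat.
Implicit Types (i j : 'I_n) (k : 'I_n.+1).

Lemma ord_pred_rpos i : ord_pred (rpos i) = lpos i.
Proof.
by apply: val_inj; rewrite /= add0n modnDr modn_small // ltnS ltnW.
Qed.

Lemma ordS_lpos i : ordS (lpos i) = rpos i.
Proof. by apply: val_inj; rewrite /= /bump modn_small // ltnS. Qed.

Lemma ord0_or_rpos k : k = ord0 \/ exists i, k = rpos i.
Proof. by case: (unliftP ord0 k) => [i ->|->]; [right; exists i|left]. Qed.

Lemma ord_max_or_lpos k : k = ord_max \/ exists i, k = lpos i.
Proof.
have [e|ne] := eqVneq k ord_max; [by left|right].
have ltkn : (k < n)%N.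
  by move: ne (ltn_ord k); rewrite -val_eqE /=; lia.
by exists (Ordinal ltkn); apply: val_inj.
Qed.

Lemma rpos_neq0 i : rpos i != ord0. Proof. by rewrite -val_eqE. Qed.
Lemma lpos_neq_max i : lpos i != ord_max.
Proof. by rewrite -val_eqE /= neq_ltn ltn_ord. Qed.

Lemma lpos_inj : injective (@lpos n).
Proof. by move=> i j /(congr1 val) /= /val_inj. Qed.

End CyclicShift.

Section Omega.
Variables (K : fieldType) (q t : K) (n : nat).
Implicit Types (f g p : {mpoly K[n.+1]}) (i j : 'I_n) (k : 'I_n.+1).
Local Notation P := {mpoly K[n.+1]}.
Local Notation om := (@omega K q n).
Local Notation T := (opT t).
Local Notation Ti := (opTinv t).
Local Notation tt := (t%:MP : P).

Definition omega_inv f : P :=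
  f \mPo [tuple (if k == ord_max then q^-1 *: 'X_(ord0 : 'I_n.+1)
                 else 'X_(ordS k)) | k < n.+1].
Local Notation omi := omega_inv.

Lemma omegaM f g : om (f * g) = om f * om g. Proof. exact: rmorphM. Qed.
Lemma omegaD f g : om (f + g) = om f + om g. Proof. exact: raddfD. Qed.
Lemma omegaB f g : om (f - g) = om f - om g. Proof. exact: raddfB. Qed.
Lemma omegaZ c f : om (c *: f) = c *: om f. Proof. exact: comp_mpolyZ. Qed.
Lemma omegaC c : om c%:MP = c%:MP. Proof. exact: comp_mpolyC. Qed.
Lemma omega1 : om 1 = 1. Proof. exact: comp_mpoly1. Qed.
Lemma omega_sum (I : Type) (r : seq I) (Q : pred I) (F : I -> P) :
  om (\sum_(x <- r | Q x) F x) = \sum_(x <- r | Q x) om (F x).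
Proof. exact: raddf_sum. Qed.
Lemma omegaX0 : om 'X_ord0 = q *: 'X_ord_max.
Proof. by rewrite /omega comp_mpolyXU -tnth_nth tnth_mktuple eqxx. Qed.
Lemma omegaXr i : om 'X_(rpos i) = 'X_(lpos i).
Proof.
rewrite /omega comp_mpolyXU -tnth_nth tnth_mktuple.
by rewrite (negPf (rpos_neq0 i)) ord_pred_rpos.
Qed.

Lemma omega_invZ c f : omi (c *: f) = c *: omi f. Proof. exact: comp_mpolyZ. Qed.
Lemma omega_invXm : omi 'X_ord_max = q^-1 *: 'X_ord0.
Proof. by rewrite /omi comp_mpolyXU -tnth_nth tnth_mktuple eqxx. Qed.
Lemma omega_invXl i : omi 'X_(lpos i) = 'X_(rpos i).
Proof.
rewrite /omi comp_mpolyXU -tnth_nth tnth_mktuple.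
by rewrite (negPf (lpos_neq_max i)) ordS_lpos.
Qed.

Hypothesis q_neq0 : q != 0.

Lemma alg_endo_omega : alg_endo om.
Proof. by split=> [x y|x y|c]; rewrite ?omegaD ?omegaM ?omegaC. Qed.

Lemma alg_endo_omega_inv : alg_endo omi.
Proof.
split=> [x y|x y|c]; [exact: raddfD|exact: rmorphM|exact: comp_mpolyC].
Qed.

#[local] Opaque swap_var omega omega_inv.

Let comp_endo := alg_endo_comp.

Lemma omegaK : cancel om omi.
Proof.
apply: (eq_alg_endo (f := omi \o om) (g := id)) => [| |k] //=.
  exact: comp_endo alg_endo_omega_inv alg_endo_omega.
case: (ord0_or_rpos k) => [->|[i ->]]; last by rewrite omegaXr omega_invXl.
by rewrite omegaX0 omega_invZ omega_invXm scalerA mulfV // scale1r.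
Qed.

Lemma omega_invK : cancel omi om.
Proof.
apply: (eq_alg_endo (f := om \o omi) (g := id)) => [| |k] //=.
  exact: comp_endo alg_endo_omega alg_endo_omega_inv.
case: (ord_max_or_lpos k) => [->|[i ->]]; last by rewrite omega_invXl omegaXr.
by rewrite omega_invXm omegaZ omegaX0 scalerA mulVf // scale1r.
Qed.

Lemma swap_varZ i c f : swap_var i (c *: f) = c *: swap_var i f.
Proof. by rewrite -!mul_mpolyC swap_varM swap_varC. Qed.

Lemma omega_swap i j f : rpos i = lpos j -> om (swap_var j f) = swap_var i (om f).
Proof.
move=> e.
apply: (eq_alg_endo (f := om \o @swap_var K n j) (g := @swap_var K n i \o om)) => [| |k] /=.
- exact: comp_endo alg_endo_omega (alg_endo_swap K j).
- exact: comp_endo (alg_endo_swap K i) alg_endo_omega.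
rewrite swap_varX.
have [->|] := eqVneq k (lpos j).
  by rewrite tpos_l omegaXr -e omegaXr swap_varX tpos_l.
have [->|] := eqVneq k (rpos j).
  by rewrite tpos_r -e !omegaXr -e swap_varX tpos_r.
move=> kr kl; rewrite tpos_D //.
case: (ord0_or_rpos k) => [->|[h kh]].
  rewrite omegaX0 swap_varZ swap_varX tpos_D //.
    by rewrite eq_sym lpos_neq_max.
  by rewrite e eq_sym lpos_neq_max.
rewrite kh omegaXr swap_varX tpos_D //.
  by apply: contraNneq kl => /lpos_inj hi; rewrite kh hi e.
by rewrite e; apply: contraNneq kr => /lpos_inj hj; rewrite kh hj.
Qed.

(** Two shifts carry the first two variables to the last two, both with the same factor [q], so the
    first adjacent swap becomes the last one. *)
Lemma omega2_swap i j f : lpos i = ord0 -> rpos j = ord_max ->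
  om (om (swap_var i f)) = swap_var j (om (om f)).
Proof.
move=> e0 em.
apply: (eq_alg_endo (f := om \o (om \o @swap_var K n i))
          (g := @swap_var K n j \o (om \o om))) => [| |k] /=.
- exact: comp_endo alg_endo_omega (comp_endo alg_endo_omega (alg_endo_swap K i)).
- exact: comp_endo (alg_endo_swap K j) (comp_endo alg_endo_omega alg_endo_omega).
rewrite swap_varX.
have omX0 : om (om 'X_ord0) = q *: 'X_(lpos j).
  by rewrite omegaX0 omegaZ -em omegaXr.
have omXr : om (om 'X_(rpos i)) = q *: 'X_(rpos j).
  by rewrite omegaXr e0 omegaX0 em.
have [->|] := eqVneq k (lpos i).
  by rewrite tpos_l omXr e0 omX0 swap_varZ swap_varX tpos_l.
have [->|] := eqVneq k (rpos i).
  by rewrite tpos_r omXr e0 omX0 swap_varZ swap_varX tpos_r.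
move=> kr kl; rewrite tpos_D //.
case: (ord0_or_rpos k) => [k0|[h kh]]; first by rewrite k0 e0 eqxx in kl.
rewrite kh omegaXr; case: (ord0_or_rpos (lpos h)) => [h0|[h' hh']].
  by move: kr; rewrite kh; move: h0; rewrite -e0 => /lpos_inj ->; rewrite eqxx.
rewrite hh' omegaXr swap_varX tpos_D //.
  apply: contraTneq isT => /lpos_inj h'j; move: (lpos_neq_max h).
  by rewrite hh' h'j em eqxx.
by rewrite em lpos_neq_max.
Qed.

#[local] Opaque opT opTinv.

Lemma omega_opT i j f : rpos i = lpos j -> om (T j f) = T i (om f).
Proof.
move=> e; apply/esym/opT_uniq; have := congr1 om (opTE t j f).
move: (T j f) => U.
rewrite !(omegaB, omegaM, omegaC, omega1) omegaD !(omegaB, omegaM, omegaC, omega1).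
by rewrite (omega_swap _ e) omegaXr -e omegaXr.
Qed.

Lemma omega2_opT i j f : lpos i = ord0 -> rpos j = ord_max ->
  om (om (T i f)) = T j (om (om f)).
Proof.
move=> e0 em; apply/esym/opT_uniq; have := congr1 om (congr1 om (opTE t i f)).
move: (T i f) => U.
rewrite !(omegaB, omegaM, omegaC, omega1) !omegaD !(omegaB, omegaM, omegaC, omega1).
rewrite (omega2_swap _ e0 em).
rewrite omegaXr e0 omegaX0 omegaZ -em omegaXr -!mul_mpolyC => h.
(* The defining equation of [T] is homogeneous of degree one in the two variables, so the common
   factor [q] cancels. *)
have q0 : q%:MP != 0 :> P by rewrite mpolyC_eq0.
apply: (mulfI q0); move: h.
set A := om (om f); set B := om (om U); set C := swap_var _ _.
move: q%:MP t%:MP A B C 'X_(lpos j) 'X_(rpos j) => u v A B C x y h.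
by transitivity ((u * x - u * y) * B); [ring|rewrite h; ring].
Qed.

End Omega.

(** * Cherednik operators and the raising operator *)

Section CherednikOperators.
Variables (K : fieldType) (q t : K) (n : nat).
Implicit Types (f g p : {mpoly K[n.+1]}) (i : 'I_n) (j k : nat).
Local Notation P := {mpoly K[n.+1]}.
Local Notation om := (@omega K q n).
Local Notation omi := (@omega_inv K q n).

#[local] Opaque swap_var opT opTinv omega omega_inv.

(* Operators indexed by [nat], equal to the identity out of range. *)
Definition natT : nat -> P -> P :=
  locked (fun k f => if insub k is Some i then opT t i f else f).
Definition natTinv : nat -> P -> P :=
  locked (fun k f => if insub k is Some i then opTinv t i f else f).
Local Notation T := natT.
Local Notation Ti := natTinv.
Local Notation x k := ('X_(inord k) : P).

Definition upT k f := foldr T f (iota 0 k).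
Definition downTinv k f := foldr Ti f (iota k (n - k)).

Lemma natTE k (lt_kn : (k < n)%N) f : T k f = opT t (Ordinal lt_kn) f.
Proof. by rewrite /T -lock insubT. Qed.

Lemma natTinvE k (lt_kn : (k < n)%N) f : Ti k f = opTinv t (Ordinal lt_kn) f.
Proof. by rewrite /Ti -lock insubT. Qed.

Lemma natT_ord i f : T i f = opT t i f. Proof. by rewrite /T -lock valK. Qed.
Lemma natTinv_ord i f : Ti i f = opTinv t i f. Proof. by rewrite /Ti -lock valK. Qed.

Lemma lpos_inord i : lpos i = inord i.
Proof. by apply: val_inj; rewrite /= inordK // ltnS ltnW. Qed.
Lemma rpos_inord i : rpos i = inord i.+1.
Proof. by apply: val_inj; rewrite /= inordK // ltnS. Qed.

Lemma foldr_filter_enum (F : 'I_n -> P -> P) (G : nat -> P -> P) (Q : pred nat) f :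
  (forall i g, G i g = F i g) ->
  foldr F f [seq j : 'I_n <- enum 'I_n | Q j] = foldr G f [seq j <- iota 0 n | Q j].
Proof.
move=> GF; rewrite -val_enum_ord filter_map.
by elim: [seq j <- _ | _] => //= i s ->; rewrite GF.
Qed.

Lemma opYE (k : 'I_n.+1) f : opY q t k f = t ^- k *: downTinv k (om (upT k f)).
Proof.
have le_kn : (k <= n)%N by rewrite -ltnS.
have iotaE : iota 0 n = iota 0 k ++ iota k (n - k) by rewrite -iotaD subnKC.
rewrite /opY (foldr_filter_enum (G := Ti) (leq k)); last exact: natTinv_ord.
rewrite (foldr_filter_enum (G := T) (fun j => j < k)%N); last exact: natT_ord.
rewrite iotaE !filter_cat.
have h1 : [seq j <- iota 0 k | (j < k)%N] = iota 0 k.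
  by apply/all_filterP/allP => j; rewrite mem_iota.
have h2 : [seq j <- iota k (n - k) | (j < k)%N] = [::].
  by apply/eqP; rewrite -(negbK (_ == _)) -has_filter; apply/hasPn => j;
     rewrite mem_iota; lia.
have h3 : [seq j <- iota 0 k | (k <= j)%N] = [::].
  by apply/eqP; rewrite -(negbK (_ == _)) -has_filter; apply/hasPn => j;
     rewrite mem_iota; lia.
have h4 : [seq j <- iota k (n - k) | (k <= j)%N] = iota k (n - k).
  by apply/all_filterP/allP => j; rewrite mem_iota => /andP[].
by rewrite h1 h2 h3 h4 cats0.
Qed.

Lemma upTS k f : upT k.+1 f = upT k (T k f).
Proof. by rewrite /upT -[k.+1]addn1 iotaD foldr_cat. Qed.

Lemma downTinvS k f : (k < n)%N -> downTinv k f = Ti k (downTinv k.+1 f).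
Proof. by move=> lt_kn; rewrite /downTinv -(subnSK lt_kn). Qed.

Lemma downTinv_n f : downTinv n f = f.
Proof. by rewrite /downTinv subnn. Qed.

Hypothesis t_neq0 : t != 0.
Hypothesis q_neq0 : q != 0.

Lemma natTZ k c f : T k (c *: f) = c *: T k f.
Proof. by rewrite /T -lock; case: insub => // i; rewrite opTZ. Qed.

Lemma natT_linear k c f g : T k (c *: f + g) = c *: T k f + T k g.
Proof. by rewrite /T -lock; case: insub => // i; rewrite opT_linear. Qed.

Lemma natTinv_linear k c f g : Ti k (c *: f + g) = c *: Ti k f + Ti k g.
Proof. by rewrite /Ti -lock; case: insub => // i; rewrite opTinv_linear. Qed.

Lemma natTK k f : Ti k (T k f) = f.
Proof. by rewrite /Ti /T -!lock; case: insubP => // i _ _; rewrite opTK. Qed.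

Lemma natTinvK k f : T k (Ti k f) = f.
Proof. by rewrite /Ti /T -!lock; case: insubP => // i _ _; rewrite opTinvK. Qed.

Lemma natT_out k f : (n <= k)%N -> T k f = f.
Proof. by move=> le_nk; rewrite /T -lock insubN // -leqNgt. Qed.


Lemma natTinvZ k c f : Ti k (c *: f) = c *: Ti k f.
Proof.
have Ti0 : Ti k 0 = 0.
  by have := natTinv_linear k (-1) 0 0; rewrite scaler0 addr0 scaleN1r addNr.
by rewrite -[c *: f]addr0 natTinv_linear Ti0 addr0.
Qed.

Lemma foldr_natT_linear s c f g :
  foldr T (c *: f + g) s = c *: foldr T f s + foldr T g s.
Proof. by elim: s => //= k s ->; rewrite natT_linear. Qed.

Lemma foldr_natTinv_linear s c f g :
  foldr Ti (c *: f + g) s = c *: foldr Ti f s + foldr Ti g s.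
Proof. by elim: s => //= k s ->; rewrite natTinv_linear. Qed.

Lemma opY_linear (k : 'I_n.+1) c f g :
  opY q t k (c *: f + g) = c *: opY q t k f + opY q t k g.
Proof.
rewrite !opYE /upT foldr_natT_linear omegaD omegaZ /downTinv foldr_natTinv_linear.
by rewrite scalerDr !scalerA mulrC.
Qed.

Lemma natT_comm j k f : (j.+1 < k)%N -> T j (T k f) = T k (T j f).
Proof.
move=> lt_jk; have [lt_kn|le_nk] := ltnP k n; last first.
  by rewrite !(natT_out _ le_nk).
have lt_jn : (j < n)%N by lia.
move: (natTE lt_kn) (natTE lt_jn).
move: (fun g => @opT_comm K t n (Ordinal lt_jn) (Ordinal lt_kn) g lt_jk).
move: (opT t (Ordinal lt_kn)) (opT t (Ordinal lt_jn)) => A1 A2 C E1 E2.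
by rewrite !(E1, E2) C.
Qed.

Lemma natT_Tinv_comm j k f : (j.+1 < k)%N -> T j (Ti k f) = Ti k (T j f).
Proof. by move=> jk; rewrite -{2}[f](natTinvK k) natT_comm // natTK. Qed.

Lemma natTinv_T_comm j k f : (j.+1 < k)%N -> T k (Ti j f) = Ti j (T k f).
Proof. by move=> jk; rewrite -{2}[f](natTinvK j) -natT_comm // natTK. Qed.

Lemma natT_braid j f : (j.+1 < n)%N -> T j (T j.+1 (T j f)) = T j.+1 (T j (T j.+1 f)).
Proof.
move=> lt_jn; have lt_jn' := ltnW lt_jn.
have e : rpos (Ordinal lt_jn') = lpos (Ordinal lt_jn) by apply: val_inj.
move: (natTE lt_jn) (natTE lt_jn') (fun g => opT_braid t g e).
move: (opT t (Ordinal lt_jn)) (opT t (Ordinal lt_jn')) => A1 A2 E1 E2 B.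
by rewrite !(E1, E2) B.
Qed.

Lemma natT_braid_inv j f :
  (j.+1 < n)%N -> T j.+1 (Ti j (Ti j.+1 f)) = Ti j (Ti j.+1 (T j f)).
Proof.
move=> lt_jn; rewrite -{2}[f](natTinvK j.+1) -{2}[Ti j.+1 f](natTinvK j).
by rewrite natT_braid // !natTK.
Qed.

Lemma upT_comm k m f : (k < m)%N -> upT k (T m f) = T m (upT k f).
Proof.
elim: k f => [|k IH] f lt_km //.
by rewrite !upTS natT_comm // IH // ltnW.
Qed.

(** Inside the chain [T_0 ... T_(k-1)] a generator commutes with all but its two neighbours; the
    braid relation with these raises its index by one. *)
Lemma upT_shift k j f : (j.+1 < k <= n)%N -> upT k (T j f) = T j.+1 (upT k f).
Proof.
elim: k f => [|k IH] f // /andP[lt_jk le_kn].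
rewrite upTS; have [lt_jk'|] := ltnP j.+1 k.
  by rewrite -natT_comm // IH ?lt_jk' ?(ltnW le_kn) // upTS.
move=> le_kj; have ek : k = j.+1 by lia.
by rewrite ek !upTS natT_braid -?ek // upT_comm ek.
Qed.

Lemma downTinv_comm k m f : (m.+1 < k)%N -> downTinv k (T m f) = T m (downTinv k f).
Proof.
move=> lt_mk; rewrite /downTinv.
have: all (fun j => m.+1 < j)%N (iota k (n - k)).
  by apply/allP => j; rewrite mem_iota => /andP[le_kj _]; apply: leq_trans le_kj.
by elim: (iota _ _) => //= j s IH /andP[lt_mj /IH ->]; rewrite natT_Tinv_comm.
Qed.

Lemma downTinv_shift k j f :
  (k <= j)%N -> (j.+1 < n)%N -> T j.+1 (downTinv k f) = downTinv k (T j f).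
Proof.
move=> le_kj lt_jn; move: {-1}(j - k)%N (erefl (j - k)%N) => d.
elim: d k le_kj => [|d IH] k le_kj ed.
  have -> : k = j by lia.
  rewrite !(downTinvS (k := j)) ?(ltnW lt_jn) // !(downTinvS (k := j.+1)) //.
  by rewrite natT_braid_inv // downTinv_comm.
rewrite !(downTinvS (k := k)); [|lia|lia].
by rewrite natTinv_T_comm ?IH //; lia.
Qed.

Lemma omega_natT k f : (k.+1 < n)%N -> om (T k.+1 f) = T k (om f).
Proof.
move=> lt_kn; have lt_kn' := ltnW lt_kn.
by rewrite (natTE lt_kn) (natTE lt_kn'); apply: omega_opT; apply: val_inj.
Qed.

Local Notation Y := (opY q t).

(** Two index shifts cancel. For [j + 1 < k] the rising chain raises [j] by one and [omega] lowers
    it again; for [k < j] the operator [omega] lowers it and the chain of inverses raises it. *)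
Lemma opY_comm (k : 'I_n.+1) j f :
  (j.+1 < k)%N || (k < j < n)%N -> Y k (T j f) = T j (Y k f).
Proof.
have le_kn : (k <= n)%N by rewrite -ltnS.
rewrite !opYE natTZ => h; congr (_ *: _); case/orP: h => [lt_jk|].
  rewrite upT_shift ?lt_jk // omega_natT ?downTinv_comm //; lia.
case: j => // j; rewrite ltnS => /andP[le_kj lt_jn].
by rewrite upT_comm // omega_natT // downTinv_shift.
Qed.

Lemma opY_succ i f :
  opT t i (Y (lpos i) (opT t i f)) = t *: Y (rpos i) f.
Proof.
rewrite !opYE val_rpos val_lpos -!natT_ord upTS natTZ downTinvS // natTinvK.
by rewrite scalerA exprS invfM mulrA mulfV // mul1r.
Qed.

(** The affine intertwiner in the style of Knop and Sahi: it raises the degree by one and rotates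
    the spectrum, multiplying by [q] the eigenvalue that moves from last to first place. *)
Definition Phi f : P := 'X_ord0 * omi f.

Lemma natTinv_X k f : (k < n)%N -> Ti k (x k.+1 * f) = t^-1 *: (x k * T k f).
Proof.
move=> lt_kn; rewrite (natTinvE lt_kn) (natTE lt_kn).
have -> : x k.+1 * f = t^-1 *: opT t (Ordinal lt_kn) (x k * opT t (Ordinal lt_kn) f).
  have e : inord k = lpos (Ordinal lt_kn) by rewrite lpos_inord.
  rewrite e opT_Xl scalerA mulVf // scale1r; congr ('X_(_) * _).
  by rewrite rpos_inord.
by rewrite -natTinvE natTinvZ natTinvE opTK.
Qed.

(** By the cross relation, each inverse generator that the variable passes turns into the generator
    itself, at the cost of a factor [1/t]. *)
Lemma downTinv_X k f : (k <= n)%N ->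
  downTinv k (x n * f) = t ^- (n - k) *: (x k * foldr T f (iota k (n - k))).
Proof.
move=> le_kn; move: {-1}(n - k)%N (erefl (n - k)%N) => d.
elim: d k le_kn => [|d IH] k le_kn ed.
  have -> : k = n by lia.
  by rewrite downTinv_n expr0 invr1 scale1r.
have lt_kn : (k < n)%N by lia.
rewrite downTinvS // IH //; last lia.
by rewrite natTinvZ natTinv_X // scalerA -invfM -exprSr.
Qed.

(** [Y_0] ends in the full chain of inverses and [Y_n] starts with the full chain of generators;
    [downTinv_X] turns the first into the second, with the factor [t^-n] that [Y_n] carries. *)
Lemma opY0_Phi f : Y ord0 (Phi f) = q *: Phi (Y ord_max f).
Proof.
have up0 g : upT (ord0 : 'I_n.+1) g = g by [].
rewrite !opYE up0 /Phi omegaM omegaX0 omega_invK // expr0 invr1 scale1r.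
have -> : ord_max = inord n :> 'I_n.+1 by apply: val_inj; rewrite /= inordK.
rewrite -scalerAl /downTinv.
have Z c g : foldr Ti (c *: g) (iota 0 (n - 0)) = c *: foldr Ti g (iota 0 (n - 0)).
  by elim: (iota _ _) => //= j s ->; rewrite natTinvZ.
rewrite Z -/(downTinv _ _) downTinv_X // subn0 inordK // subnn /=.
rewrite omega_invZ omegaK // -scalerAr.
by have -> : inord 0 = ord0 :> 'I_n.+1 by apply: val_inj; rewrite /= inordK.
Qed.

Lemma natT_omega_inv k f : (k.+1 < n)%N -> T k.+1 (omi f) = omi (T k f).
Proof. by move=> lt_kn; rewrite -{2}[f](omega_invK q_neq0) -omega_natT // omegaK. Qed.

Lemma natTinv_omega_inv k f : (k.+1 < n)%N -> omi (Ti k f) = Ti k.+1 (omi f).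
Proof. by move=> lt_kn; rewrite -{2}[f](natTinvK k) -natT_omega_inv // natTK. Qed.

Lemma natT_X0 k f : T k.+1 ('X_ord0 * f) = 'X_ord0 * T k.+1 f.
Proof.
have [lt_kn|le_nk] := ltnP k.+1 n; last by rewrite !(natT_out _ le_nk).
by rewrite !(natTE lt_kn); apply: opT_XD.
Qed.

Lemma natTinv_X0 k f : Ti k.+1 ('X_ord0 * f) = 'X_ord0 * Ti k.+1 f.
Proof. by rewrite -{1}[f](natTinvK k.+1) -natT_X0 natTK. Qed.

(* The key case of [Y (k+1) Phi = Phi Y k]: both sides equal [t x_1 omega h]
   with [h := T_1^-1 omega^-1 g], by [omega^2 T_1 = T_(n-1) omega^2]. *)
Lemma omega_T0_X0 g : (0 < n)%N ->
  om (T 0 ('X_ord0 * omi g)) = t *: ('X_ord0 * omi (Ti n.-1 (om g))).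
Proof.
move=> n_gt0; have lt_n : (n.-1 < n)%N by lia.
pose h := Ti 0 (omi g).
have eg : omi g = T 0 h by rewrite natTinvK.
have eog : om g = T n.-1 (om (om h)).
  rewrite -[g](omega_invK q_neq0) eg (natTE n_gt0) (natTE lt_n).
  by apply: omega2_opT => //; apply: val_inj => //=; rewrite /bump /=; lia.
rewrite eog natTK omegaK // eg !(natTE n_gt0).
have -> : ord0 = lpos (Ordinal n_gt0) by apply: val_inj.
rewrite opT_Xl omegaZ omegaM omegaXr; congr (_ *: ('X_(_) * _)).
Qed.

Lemma opYS_Phi i f : Y (rpos i) (Phi f) = Phi (Y (lpos i) f).
Proof.
have lt_in := ltn_ord i; have n_gt0 : (0 < n)%N by lia.
rewrite !opYE val_rpos val_lpos /Phi omega_invZ -scalerAr.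
have -> : upT i.+1 ('X_ord0 * omi f) = T 0 ('X_ord0 * omi (upT i f)).
  rewrite /upT /=; congr (T 0 _).
  have : all (fun j => j.+1 < n)%N (iota 0 i).
    by apply/allP => j; rewrite mem_iota; lia.
  rewrite -[1%N]/(1 + 0)%N iotaDl.
  elim: (iota 0 i) => //= j s IH /andP[lt_jn /IH ->].
  by rewrite add1n natT_X0 natT_omega_inv.
rewrite omega_T0_X0 //; set g := om _.
have Z c p k : downTinv k (c *: p) = c *: downTinv k p.
  by rewrite /downTinv; elim: (iota _ _) => //= j s ->; rewrite natTinvZ.
rewrite Z scalerA exprS invfM mulrAC mulVf // mul1r; congr (_ *: _).
rewrite /downTinv.
(* The innermost inverse, of index [n - 1], is the one produced by [omega_T0_X0]; the others come
   from the chain of the left side, with indices lowered by one. *)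
have -> : iota i (n - i) = rcons (iota i (n - i.+1)) n.-1.
  have -> : (n - i = n - i.+1 + 1)%N by lia.
  by rewrite iotaD /= -cats1; congr (_ ++ [:: _]); lia.
rewrite foldr_rcons; move: (Ti n.-1 g) => {}g.
have -> : iota i.+1 (n - i.+1) = map succn (iota i (n - i.+1)).
  by rewrite -[i.+1]/(1 + i)%N iotaDl.
have : all (fun j => j.+1 < n)%N (iota i (n - i.+1)).
  by apply/allP => j; rewrite mem_iota; lia.
elim: (iota _ _) => //= j s IH /andP[lt_jn /IH ->].
by rewrite natTinv_X0 natTinv_omega_inv.
Qed.

Lemma opY1 (k : 'I_n.+1) : Y k 1 = t ^- (n - k) *: 1.
Proof.
have le_kn : (k <= n)%N by rewrite -ltnS.
have T1 j : (j < n)%N -> T j 1 = t *: 1 by move=> lt_jn; rewrite natTE opT1.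
have Ti1 j : (j < n)%N -> Ti j 1 = t^-1 *: 1.
  by move=> lt_jn; rewrite -{2}(natTK j 1) T1 // natTinvZ scalerA mulVf // scale1r.
have up j : (j <= n)%N -> upT j 1 = t ^+ j *: 1.
  elim: j => [|j IH] lt_jn; first by rewrite expr0 scale1r.
  rewrite upTS T1 //.
  have -> : upT j (t *: 1) = t *: upT j 1.
    by rewrite /upT; elim: (iota _ _) => //= m s ->; rewrite natTZ.
  by rewrite IH ?(ltnW lt_jn) // scalerA exprS.
have down j : (j <= n)%N -> downTinv j 1 = t ^- (n - j) *: 1.
  move=> le_jn; move: {-1}(n - j)%N (erefl (n - j)%N) => d.
  elim: d j le_jn => [|d IH] j le_jn ed.
    have -> : j = n by lia.
    by rewrite downTinv_n expr0 invr1 scale1r.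
  rewrite downTinvS ?IH; [|lia..].
  have lt_jn : (j < n)%N by lia.
  by rewrite natTinvZ Ti1 // scalerA -invfM -exprSr.
rewrite opYE up // omegaZ omega1.
have Z c p j : downTinv j (c *: p) = c *: downTinv j p.
  by rewrite /downTinv; elim: (iota _ _) => //= m s ->; rewrite natTinvZ.
by rewrite Z down // !scalerA mulVf ?mul1r // expf_neq0.
Qed.

End CherednikOperators.

(** * The action of the Hecke generators on monomials *)

Section MonomialAction.
Variable n : nat.
Implicit Types (z m : 'X_{1..n.+1}) (i : 'I_n) (k : 'I_n.+1).

Lemma swap_compE i z k : swap_comp i z k = z (tpos i k).
Proof. by rewrite /swap_comp mnmE. Qed.
Lemma swap_comp_l i z : swap_comp i z (lpos i) = z (rpos i).
Proof. by rewrite swap_compE tpos_l. Qed.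
Lemma swap_comp_r i z : swap_comp i z (rpos i) = z (lpos i).
Proof. by rewrite swap_compE tpos_r. Qed.
Lemma swap_comp_D i z k : k != lpos i -> k != rpos i -> swap_comp i z k = z k.
Proof. by move=> kl kr; rewrite swap_compE tpos_D. Qed.

Lemma swap_compK i : involutive (@swap_comp n i).
Proof. by move=> z; apply/mnmP => k; rewrite !swap_compE tpermK. Qed.

Lemma swap_comp_id i z : z (lpos i) = z (rpos i) -> swap_comp i z = z.
Proof.
move=> e; apply/mnmP => k.
have [->|kl] := eqVneq k (lpos i); first by rewrite swap_comp_l.
have [->|kr] := eqVneq k (rpos i); first by rewrite swap_comp_r.
by rewrite swap_comp_D.
Qed.

Lemma swap_comp_eq i z : (swap_comp i z == z) = (z (lpos i) == z (rpos i)).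
Proof.
apply/eqP/eqP => [e|/swap_comp_id //].
by rewrite -[in LHS]e swap_comp_l.
Qed.

(* Strictly between [z] and [swap_comp i z] on the root string. *)
Definition inner i z m : bool :=
  [&& m (lpos i) + m (rpos i) == z (lpos i) + z (rpos i),
      minn (z (lpos i)) (z (rpos i)) < m (lpos i),
      m (lpos i) < maxn (z (lpos i)) (z (rpos i))
    & [forall k, (k == lpos i) || (k == rpos i) || (m k == z k)]]%N.

Lemma inner_D i z m k : inner i z m -> k != lpos i -> k != rpos i -> m k = z k.
Proof.
by case/and4P=> _ _ _ /forallP/(_ k) + kl kr; rewrite (negPf kl) (negPf kr) => /eqP.
Qed.

Lemma inner_swap i z m : inner i (swap_comp i z) m = inner i z m.
Proof.
rewrite /inner swap_comp_l swap_comp_r addnC [in RHS]addnC minnC maxnC.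
rewrite [(z (rpos i) + _)%N]addnC [in LHS]addnC; congr [&& _, _, _ & _].
apply: eq_forallb => k; case: eqP => //= kl; case: eqP => //= kr.
by rewrite swap_comp_D //; apply/eqP.
Qed.

Lemma inner_neq i z m : inner i z m -> m != z.
Proof. by apply: contraTneq => ->; rewrite /inner; lia. Qed.

Lemma sum_lr i (F : 'I_n.+1 -> nat) :
  (\sum_k F k = F (lpos i) + F (rpos i)
     + \sum_(k | (k != lpos i) && (k != rpos i)) F k)%N.
Proof.
rewrite (bigD1 (lpos i)) //= (bigD1 (rpos i)) /=; last by rewrite eq_sym lpos_neq_rpos.
by rewrite addnA.
Qed.

Lemma sum2_lr i (G : 'I_n.+1 -> 'I_n.+1 -> nat) :
  let l := lpos i in let r := rpos i in
  (\sum_a \sum_b G a b = (G l l + G l r + G r l + G r r)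
     + \sum_(k | (k != l) && (k != r)) (G l k + G r k + G k l + G k r)
     + \sum_(a | (a != l) && (a != r)) \sum_(b | (b != l) && (b != r)) G a b)%N.
Proof.
move=> l r; rewrite (sum_lr i) -/l -/r (sum_lr i (G l)) (sum_lr i (G r)) -/l -/r.
under [X in (_ + X)%N]eq_bigr => a _ do rewrite (sum_lr i (G a)) -/l -/r.
by rewrite !big_split /=; lia.
Qed.

Definition nrm z : nat := (\sum_k z k ^ 2)%N.

Lemma nrm_swap i z : nrm (swap_comp i z) = nrm z.
Proof.
rewrite /nrm !(sum_lr i) swap_comp_l swap_comp_r [(_ ^ _ + _)%N]addnC.
by congr (_ + _)%N; apply: eq_bigr => k /andP[kl kr]; rewrite swap_comp_D.
Qed.

(** Strict convexity of the square: two entries with fixed sum have a smaller sum of squares when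
    they are closer together. *)
Lemma nrm_inner i z m : inner i z m -> (nrm m < nrm z)%N.
Proof.
move=> im; rewrite /nrm !(sum_lr i).
rewrite (eq_bigr (fun k => z k ^ 2)%N) => [|k /andP[kl kr]]; last first.
  by rewrite (inner_D im).
rewrite ltn_add2r; case/and4P: im; move: (m _) (m _) (z _) (z _) => a b c d.
move=> /eqP e lo hi _.
have -> : b = (c + d - a)%N by lia.
by have [cd|dc] := leqP c d; move: lo hi; rewrite ?(minn_idPl cd) ?(maxn_idPr cd)
   ?(minn_idPr (ltnW dc)) ?(maxn_idPl (ltnW dc)) => lo hi; nia.
Qed.

(* [z i] and [z j] contribute the distance of [z i - z j] to the pair [{0, 1}];
   the total is the length of the affine permutation attached to [z]. *)
Definition lenf (x y : nat) : nat := (if y < x then x - y - 1 else y - x)%N.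
Definition len z : nat :=
  (\sum_(a : 'I_n.+1) \sum_(b : 'I_n.+1) if a < b then lenf (z a) (z b) else 0)%N.

Lemma lenE i z :
  len z = (lenf (z (lpos i)) (z (rpos i))
   + \sum_(k | (k != lpos i) && (k != rpos i))
       (if (k < i)%N then lenf (z k) (z (lpos i)) + lenf (z k) (z (rpos i))
        else lenf (z (lpos i)) (z k) + lenf (z (rpos i)) (z k))
   + \sum_(a | (a != lpos i) && (a != rpos i))
       \sum_(b | (b != lpos i) && (b != rpos i)) if a < b then lenf (z a) (z b) else 0)%N.
Proof.
rewrite /len (sum2_lr i) !ltnn val_rpos val_lpos; congr (_ + _ + _)%N.
  by rewrite ltnSn ltnNge leqnSn /=; lia.
apply: eq_bigr => k /andP[]; rewrite -!val_eqE /= /bump leq0n add1n => kl kr.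
have [ki|ik] := ltnP k i.
  by rewrite ltnNge ltnW //= (leq_trans ki) // ltnNge (leqW (ltnW ki)) /=; lia.
have ik' : (i < k)%N by rewrite ltn_neqAle eq_sym kl.
have ik2 : (i.+1 < k)%N by rewrite ltn_neqAle eq_sym kr.
have -> : (k < i.+1)%N = false by lia.
by rewrite ik' ik2 !addn0.
Qed.

(** Only the pair of exchanged positions changes its contribution, losing the -1 in [lenf]. Within
    an orbit the partition is therefore shortest. *)
Lemma len_swap i z : (z (rpos i) < z (lpos i))%N -> len (swap_comp i z) = (len z).+1.
Proof.
move=> lt_rl; rewrite !(lenE i) swap_comp_l swap_comp_r.
have -> : lenf (z (rpos i)) (z (lpos i)) = (lenf (z (lpos i)) (z (rpos i))).+1.
  by rewrite /lenf lt_rl ltnNge (ltnW lt_rl) /=; lia.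
rewrite !addSn; congr (_.+1); congr (_ + _ + _)%N.
  apply: eq_bigr => k /andP[kl kr]; rewrite swap_comp_D //.
  by case: ifP => _; rewrite addnC.
by apply: eq_bigr => a /andP[al ar]; apply: eq_bigr => b /andP[bl br];
   rewrite !swap_comp_D.
Qed.

Lemma lenf_inner a b c d :
  (a + b = c + d -> minn c d < a -> a < maxn c d -> lenf a b <= lenf c d)%N.
Proof. by rewrite /lenf; case: (ltnP b a); case: (ltnP d c); lia. Qed.

(** For fixed [x] the function [lenf x] takes the values ..., 1, 0, 0, 1, ... and is convex, so
    moving two entries with fixed sum towards each other cannot increase the total. *)
Lemma lenf_convexl x a b c d :
  (a + b = c + d -> minn c d < a -> a < maxn c d ->
   lenf x a + lenf x b <= lenf x c + lenf x d)%N.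
Proof.
rewrite /lenf; case: (ltnP a x); case: (ltnP b x); case: (ltnP c x); case: (ltnP d x); lia.
Qed.

Lemma lenf_convexr x a b c d :
  (a + b = c + d -> minn c d < a -> a < maxn c d ->
   lenf a x + lenf b x <= lenf c x + lenf d x)%N.
Proof.
rewrite /lenf; case: (ltnP x a); case: (ltnP x b); case: (ltnP x c); case: (ltnP x d); lia.
Qed.

Lemma len_inner i z m : inner i z m -> (len m <= len z)%N.
Proof.
move=> im; rewrite !(lenE i); apply: leq_add; last first.
  apply: eq_leq; apply: eq_bigr => a /andP[al ar]; apply: eq_bigr => b /andP[bl br].
  by rewrite !(inner_D im).
have [] := and4P im; move=> /eqP e lo hi _; apply: leq_add; first exact: lenf_inner.
apply: leq_sum => k /andP[kl kr]; rewrite !(inner_D im kl kr).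
by case: ifP => _; [apply: lenf_convexl|apply: lenf_convexr].
Qed.

(** * Matrix entries of the Hecke generators in the monomial basis *)

Section Coefficients.
Variables (K : fieldType) (t : K).
Local Notation P := {mpoly K[n.+1]}.
Local Notation T := (opT t).

Lemma swap_varXm i z : swap_var i 'X_[z] = 'X_[swap_comp i z] :> P.
Proof.
by rewrite /swap_var msymX tpermV.
Qed.

#[local] Opaque swap_var opT.

Lemma opT_X_eq i z : z (lpos i) = z (rpos i) -> T i 'X_[z] = t *: 'X_[z] :> P.
Proof.
move=> e; rewrite -['X_[z] in LHS]mul1r opT_mul_sym; last first.
  by rewrite swap_varXm swap_comp_id.
by rewrite opT1 -scalerAl mul1r.
Qed.

(** The exponent of [x^z (x_(i+1) / x_i)^d]. The truncated subtraction is harmless, as [d] is at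
    most [z_i - z_(i+1)] wherever the string is used. *)
Definition string i z (d : nat) : 'X_{1..n.+1} :=
  [multinom (if k == lpos i then z k - d else if k == rpos i then z k + d else z k)%N
   | k < n.+1].

Lemma string_l i z d : string i z d (lpos i) = (z (lpos i) - d)%N.
Proof. by rewrite mnmE eqxx. Qed.
Lemma string_r i z d : string i z d (rpos i) = (z (rpos i) + d)%N.
Proof. by rewrite mnmE eqxx eq_sym (negPf (lpos_neq_rpos i)). Qed.
Lemma string_D i z d k : k != lpos i -> k != rpos i -> string i z d k = z k.
Proof. by move=> kl kr; rewrite mnmE (negPf kl) (negPf kr). Qed.

Lemma string_inner i z d :
  (0 < d < z (lpos i) - z (rpos i))%N -> inner i z (string i z d).
Proof.
move=> hd; apply/and4P; rewrite string_l string_r; split; try lia.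
apply/forallP => k; case: eqP => //= kl; case: eqP => //= kr.
by rewrite string_D //; apply/eqP.
Qed.

(** The divided difference of a monomial is a geometric sum; multiplied by [x_i - x_(i+1)] it
    telescopes, which is [tele], and [e1] identifies its last term. *)
Lemma opT_X_gt i z : (z (rpos i) < z (lpos i))%N ->
  T i 'X_[z] = 'X_[swap_comp i z]
    + (1 - t) *: \sum_(1 <= d < z (lpos i) - z (rpos i)) 'X_[string i z d] :> P.
Proof.
move=> lt_rl; set d := (_ - _)%N; pose y e : P := 'X_(rpos i) * 'X_[string i z e].
have d_gt0 : (0 < d)%N by rewrite subn_gt0.
have z0 : z = string i z 0.
  by apply/mnmP => k; rewrite mnmE subn0 addn0 !if_same.
have zd : swap_comp i z = string i z d.
  apply/mnmP => k.
  have [->|kl] := eqVneq k (lpos i); first by rewrite swap_comp_l string_l /d; lia.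
  have [->|kr] := eqVneq k (rpos i); first by rewrite swap_comp_r string_r /d; lia.
  by rewrite swap_comp_D // string_D.
have xl e : (e < d)%N -> 'X_(lpos i) * 'X_[string i z e.+1] = y e :> P.
  move=> lt_ed; rewrite /y -!mpolyXD; congr 'X_[_]; apply/mnmP => k.
  rewrite !mnmDE !mnm1E; have lt_e : (e < z (lpos i))%N by rewrite /d in lt_ed; lia.
  have [<-|kl] := eqVneq (lpos i) k.
    by rewrite !string_l eq_sym (negPf (lpos_neq_rpos i)); lia.
  have [<-|kr] := eqVneq (rpos i) k; first by rewrite !string_r; lia.
  by rewrite !string_D // eq_sym.
apply: opT_uniq; rewrite swap_varXm zd -mul_mpolyC mpolyCB mpolyC1.
have tele : ('X_(lpos i) - 'X_(rpos i)) * \sum_(1 <= e < d) 'X_[string i z e]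
     = y 0%N - y d.-1 :> P.
  rewrite mulr_sumr -{1}(prednK d_gt0) big_add1 /=.
  rewrite (eq_big_nat _ _ (F2 := fun e => - y e.+1 - - y e)) => [|e /andP[_ he]].
    by rewrite telescope_sumr // opprK addrC.
  by rewrite mulrBl xl ?opprK 1?addrC //; lia.
have e1 : 'X_(lpos i) * 'X_[string i z d] = y d.-1 :> P.
  by rewrite -[in LHS](prednK d_gt0) xl // prednK.
apply: (lin_comb2 (c1 := 1 - t%:MP) (c2 := 1 - t%:MP) tele e1).
have -> : 'X_[z] = 'X_[string i z 0] :> P by rewrite -z0.
rewrite {1}/y; move: (\sum_(1 <= e < d) _) (y d.-1) => S b.
move: 'X_(lpos i) 'X_(rpos i) 'X_[string i z d] 'X_[string i z 0] t%:MP => x x' u v w.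
ring.
Qed.

Lemma opT_X_lt i z : (z (lpos i) < z (rpos i))%N ->
  T i 'X_[z] = t *: ('X_[swap_comp i z] + 'X_[z]) - T i 'X_[swap_comp i z] :> P.
Proof.
move=> _; rewrite -{1}[z](swap_compK i) -[in LHS]swap_varXm opT_swap.
by rewrite swap_varXm swap_compK.
Qed.

Lemma sum_string_coef i z m :
  ~~ inner i z m ->
  (\sum_(1 <= d < z (lpos i) - z (rpos i)) 'X_[string i z d] : P)@_m = 0.
Proof.
move=> nim; rewrite raddf_sum /= big_nat big1 // => d hd.
rewrite mcoeffX; case: eqP => // e; case/negP: nim; rewrite -e; exact: string_inner.
Qed.

Lemma opT_X_coef0 i z m : m != z -> m != swap_comp i z -> ~~ inner i z m ->
  (T i 'X_[z] : P)@_m = 0.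
Proof.
have gt z' : (z' (rpos i) < z' (lpos i))%N -> m != swap_comp i z' -> ~~ inner i z' m ->
    (T i 'X_[z'] : P)@_m = 0.
  move=> lt_rl ms mi; rewrite opT_X_gt // mcoeffD mcoeffZ sum_string_coef // mulr0 addr0.
  by rewrite mcoeffX eq_sym (negPf ms).
move=> mz ms mi; have [lt_rl|lt_lr|e] := ltngtP (z (rpos i)) (z (lpos i)).
- exact: gt.
- rewrite opT_X_lt // mcoeffB gt ?swap_comp_l ?swap_comp_r ?swap_compK ?inner_swap //.
  by rewrite subr0 mcoeffZ mcoeffD !mcoeffX ![_ == m]eq_sym (negPf mz) (negPf ms) addr0 mulr0.
- by rewrite opT_X_eq // mcoeffZ mcoeffX eq_sym (negPf mz) mulr0.
Qed.

Lemma opT_X_coef_swap i z : (z (rpos i) < z (lpos i))%N ->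
  (T i 'X_[z] : P)@_(swap_comp i z) = 1.
Proof.
move=> lt_rl; rewrite opT_X_gt // mcoeffD mcoeffZ sum_string_coef ?mulr0 ?addr0.
  by rewrite mcoeffX eqxx.
by apply: contraTN isT; rewrite -inner_swap => /inner_neq; rewrite eqxx.
Qed.

Lemma opT_X_coef_id i z : (z (rpos i) < z (lpos i))%N -> (T i 'X_[z] : P)@_z = 0.
Proof.
move=> lt_rl; rewrite opT_X_gt // mcoeffD mcoeffZ sum_string_coef ?mulr0 ?addr0.
  by rewrite mcoeffX swap_comp_eq gtn_eqF.
by apply: contraTN isT => /inner_neq; rewrite eqxx.
Qed.

Lemma opT_coef i (p : P) m :
  (T i p)@_m = \sum_(z <- msupp p) p@_z * (T i 'X_[z] : P)@_m.
Proof.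
rewrite {1}[p]mpolyE opT_sum raddf_sum /=; apply: eq_bigr => z _.
by rewrite opTZ mcoeffZ.
Qed.

Lemma sum_msupp_delta (p : P) z : \sum_(m <- msupp p) p@_m * (m == z)%:R = p@_z.
Proof.
rewrite [in RHS](mpolyE p) raddf_sum /=.
by apply: eq_bigr => m _; rewrite mcoeffZ mcoeffX.
Qed.

(* On coefficients of maximal norm only the two ends of the root string
   contribute. *)
Lemma opT_coef_top i (p : P) z :
  (forall m, (nrm z < nrm m)%N -> p@_m = 0) ->
  (T i p)@_z =
    if (z (rpos i) < z (lpos i))%N then t * p@_(swap_comp i z)
    else if z (rpos i) == z (lpos i) then t * p@_z
    else p@_(swap_comp i z) + (t - 1) * p@_z.
Proof.
move=> ptop; rewrite opT_coef.
have F0 m : p@_m != 0 -> m != z -> m != swap_comp i z -> (T i 'X_[m] : P)@_z = 0.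
  move=> pm mz ms; apply: opT_X_coef0; first by rewrite eq_sym.
    by apply: contraNneq ms => ->; rewrite swap_compK.
  by apply: contraNN pm => /nrm_inner /ptop ->.
(* [A] and [B] are the entries of [T_i] from [x^z] and from its swap to [x^z]. The guard on [B]
   prevents counting one monomial twice when the two entries of [z] agree. *)
have [A [B [eA eB eAB]]] : exists A, exists B, [/\ (T i 'X_[z] : P)@_z = A,
    z != swap_comp i z -> (T i 'X_[swap_comp i z] : P)@_z = B
  & forall x y : K, (if (z (rpos i) < z (lpos i))%N then t * y
    else if z (rpos i) == z (lpos i) then t * x
    else y + (t - 1) * x) = x * A + (if z != swap_comp i z then y * B else 0)].
  rewrite [z == _]eq_sym swap_comp_eq.
  have [lt_rl|lt_lr|e] := ltngtP (z (rpos i)) (z (lpos i)).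
  - exists 0, t; split=> [|_|x y]; first exact: opT_X_coef_id.
      rewrite opT_X_lt ?swap_comp_l ?swap_comp_r // swap_compK mcoeffB opT_X_coef_id //.
      rewrite subr0 mcoeffZ mcoeffD !mcoeffX eqxx swap_comp_eq.
      by rewrite gtn_eqF // addr0 mulr1.
    by rewrite mulr0 add0r mulrC.
  - have c1 : (T i 'X_[swap_comp i z] : P)@_z = 1.
      have := @opT_X_coef_swap i (swap_comp i z).
      by rewrite swap_compK swap_comp_l swap_comp_r; apply.
    exists (t - 1), 1; split=> [|//|x y].
    + rewrite opT_X_lt // mcoeffB c1.
      by rewrite mcoeffZ mcoeffD !mcoeffX eqxx swap_comp_eq ltn_eqF // add0r mulr1.
    + by rewrite mulr1 addrC mulrC.
  - exists t, 0; split=> [||x y]; rewrite ?eqxx //.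
      by rewrite opT_X_eq // mcoeffZ mcoeffX eqxx mulr1.
    by rewrite addr0 mulrC.
rewrite eAB; set s := swap_comp i z.
rewrite -(sum_msupp_delta p z) -(sum_msupp_delta p s) !mulr_suml.
have [es|ns] /= := eqVneq z s.
  rewrite addr0; apply: eq_big_seq => m; rewrite mcoeff_msupp => pm.
  have [->|mz] := eqVneq m z; first by rewrite eA mulr1.
  by rewrite F0 ?mulr0 ?mul0r // -/s -es.
rewrite -big_split /=; apply: eq_big_seq => m; rewrite mcoeff_msupp => pm.
have [->|mz] := eqVneq m z; first by rewrite eA (negPf ns) mulr1 mulr0 mul0r addr0.
have [->|ms] := eqVneq m s; first by rewrite eB // mulr1 mulr0 mul0r add0r.
by rewrite F0 // !mulr0 !mul0r addr0.
Qed.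

Definition lead_at (p : P) z : Prop :=
  p@_z = 1 /\ forall m, m != z -> p@_m != 0 -> (len m < len z)%N.

Lemma len_swap_le i z : (len (swap_comp i z) <= (len z).+1)%N.
Proof.
have [lt_rl|lt_lr|e] := ltngtP (z (rpos i)) (z (lpos i)).
- by rewrite len_swap.
- have := @len_swap i (swap_comp i z).
  by rewrite swap_compK swap_comp_l swap_comp_r => /(_ lt_lr) ->; lia.
- by rewrite swap_comp_id.
Qed.

(** [T_i] raises the length of a monomial by at most one. Length [len z + 1] is attained only by the
    swap of [z] itself, since every other monomial of [p] is strictly shorter than [z]. *)
Lemma opT_lead i (p : P) z : (z (rpos i) < z (lpos i))%N ->
  lead_at p z -> lead_at (T i p) (swap_comp i z).
Proof.
move=> lt_rl [pz pm]; have ls := len_swap lt_rl; split; last first.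
  move=> m ms; rewrite ls ltnS opT_coef leqNgt; apply: contraNN => lt_zm.
  apply/eqP; rewrite big_seq big1 // => w; rewrite mcoeff_msupp => pw.
  have [ewz|wz] := eqVneq w z.
    rewrite ewz opT_X_coef0 ?mulr0 //; first by apply: contraTneq lt_zm => ->; rewrite ltnn.
    by apply: contraTN lt_zm => /len_inner; rewrite leqNgt.
  have ltw := pm _ wz pw.
  rewrite opT_X_coef0 ?mulr0 //.
  - by apply: contraTneq lt_zm => ->; lia.
  - by apply: contraTneq lt_zm => ->; have := len_swap_le i w; lia.
  - by apply: contraTN lt_zm => /len_inner; lia.
rewrite opT_coef -[RHS]pz -(sum_msupp_delta p z); apply: eq_big_seq => w.
rewrite mcoeff_msupp => pw; congr (_ * _).
have [->|wz] := eqVneq w z; first exact: opT_X_coef_swap.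
have ltw := pm _ wz pw; apply: opT_X_coef0.
- by apply: contraTneq ltw => <-; lia.
- by apply: contraNneq wz => /(can_inj (swap_compK i)) ->.
- by apply: contraTN ltw => /len_inner; lia.
Qed.

End Coefficients.
End MonomialAction.

(** * Rotation of compositions and the spectrum *)

Section Rotation.
Variable n : nat.
Implicit Types (z m : 'X_{1..n.+1}) (i : 'I_n) (k : 'I_n.+1).

Lemma ord_pred_ord0 : ord_pred ord0 = ord_max :> 'I_n.+1.
Proof. by apply: val_inj; rewrite /= modn_small. Qed.

Lemma rot_comp0 z : rot_comp z ord0 = z ord_max.
Proof. by rewrite /rot_comp mnmE ord_pred_ord0. Qed.
Lemma rot_comp_r z i : rot_comp z (rpos i) = z (lpos i).
Proof. by rewrite /rot_comp mnmE ord_pred_rpos. Qed.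

Definition unrot_comp z : 'X_{1..n.+1} := [multinom z (ordS k) | k < n.+1].

Lemma rot_compK : cancel (@rot_comp n) unrot_comp.
Proof. by move=> z; apply/mnmP => k; rewrite !mnmE ordSK. Qed.
Lemma unrot_compK : cancel unrot_comp (@rot_comp n).
Proof. by move=> z; apply/mnmP => k; rewrite !mnmE ord_predK. Qed.

Lemma sum_rot (F : 'I_n.+1 -> nat) :
  (\sum_k F k = F ord_max + \sum_(i < n) F (lpos i))%N.
Proof. by rewrite big_ord_recr addnC. Qed.

Lemma sum_rot' (F : 'I_n.+1 -> nat) :
  (\sum_k F k = F ord0 + \sum_(i < n) F (rpos i))%N.
Proof. by rewrite big_ord_recl. Qed.

Lemma nrm_rot z : nrm (rot_comp z) = nrm z.
Proof.
rewrite /nrm sum_rot' sum_rot rot_comp0; congr (_ + _)%N.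
by apply: eq_bigr => i _; rewrite rot_comp_r.
Qed.

Definition Phi_comp z : 'X_{1..n.+1} := (U_(ord0) + rot_comp z)%MM.

Lemma Phi_comp0 z : Phi_comp z ord0 = (z ord_max).+1.
Proof. by rewrite mnmDE mnm1E rot_comp0. Qed.
Lemma Phi_comp_r z i : Phi_comp z (rpos i) = z (lpos i).
Proof. by rewrite mnmDE mnm1E rot_comp_r. Qed.

Lemma Phi_comp_inj : injective Phi_comp.
Proof. by move=> z m /addmI /(can_inj rot_compK). Qed.

(** The affine rotation has length zero: the unit added to the moved entry is exactly offset by the
    -1 in [lenf] when that entry passes from the right to the left of all others. *)
Lemma len_Phi z : len (Phi_comp z) = len z.
Proof.
pose G m (a b : 'I_n.+1) := (if a < b then lenf (m a) (m b) else 0)%N.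
pose H i := (\sum_(j < n) if i < j then lenf (z (lpos i)) (z (lpos j)) else 0)%N.
have lenG m : len m = (\sum_a \sum_b G m a b)%N by [].
have e1 : (\sum_b G (Phi_comp z) ord0 b = \sum_(i < n) lenf (z (lpos i)) (z ord_max))%N.
  rewrite sum_rot' {1}/G ltnn add0n; apply: eq_bigr => i _.
  rewrite /G /= Phi_comp0 Phi_comp_r /lenf ltnS.
  by case: (leqP (z (lpos i)) (z ord_max)); lia.
have e2 i : (\sum_b G (Phi_comp z) (rpos i) b = H i)%N.
  by rewrite sum_rot' add0n; apply: eq_bigr => j _; rewrite /G !Phi_comp_r.
have e3 : (\sum_b G z ord_max b = 0)%N.
  by rewrite big1 // => b _; rewrite /G ltnNge -ltnS ltn_ord.
have e4 i : (\sum_b G z (lpos i) b = lenf (z (lpos i)) (z ord_max) + H i)%N.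
  by rewrite sum_rot {1}/G /= ltn_ord.
transitivity (\sum_(i < n) (lenf (z (lpos i)) (z ord_max) + H i))%N; rewrite lenG.
  by rewrite sum_rot' e1 big_split; congr (_ + _)%N; apply: eq_bigr.
by apply/esym; rewrite sum_rot e3 add0n; apply: eq_bigr.
Qed.

(** A strict total order on positions: larger parts rank higher, and ties are won by the position
    further right. Its rank function [rk] is the exponent of [1/t] in the eigenvalue. *)
Definition above z k (j : 'I_n.+1) : bool :=
  ((k < j) && (z k <= z j) || (j < k) && (z k < z j))%N.
Definition rk z k : nat := (\sum_j above z k j)%N.

Lemma eigvalE (K : fieldType) (q t : K) k z :
  eigval q t k z = q ^+ z k * t ^- rk z k.
Proof.
rewrite /eigval /rk; congr (_ * t ^- _).
rewrite -!sum1dep_card [X in (X + _)%N]big_mkcond [X in (_ + X)%N]big_mkcond.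
rewrite -big_split /=; apply: eq_bigr => j _.
by rewrite /above; case: (ltngtP k j) => //= _; case: ifP.
Qed.

Lemma rk_lt z k j : above z k j -> (rk z j < rk z k)%N.
Proof.
move=> kj; rewrite /rk [in ltnRHS](bigD1 j) //= kj add1n ltnS.
rewrite (bigD1 j) //= {1}/above ltnn /= add0n; apply: leq_sum => l lj.
case E: (above z j l) => //; suff -> : above z k l by [].
have [ekl|kl] := eqVneq k l; first by move: kj E; rewrite /above ekl; lia.
move: kj E kl lj; rewrite /above -!val_eqE /=; move: (z k) (z j) (z l) => a b c; lia.
Qed.

Lemma rk_inj z : injective (rk z).
Proof.
move=> k j e; apply/eqP; apply: contraT => kj.
have: above z k j || above z j k.
  by move: kj; rewrite /above -val_eqE /=; move: (z k) (z j) => a b; lia.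
by case/orP=> /rk_lt; rewrite e ltnn.
Qed.

Lemma rk_swap i z k : z (lpos i) != z (rpos i) ->
  rk (swap_comp i z) k = rk z (tpos i k).
Proof.
move=> ne; rewrite /rk [RHS](reindex_inj (@perm_inj _ (tpos i))) /=.
apply: eq_bigr => j _; rewrite /above !swap_compE.
have sE h : (h = lpos i /\ tpos i h = rpos i) \/ (h = rpos i /\ tpos i h = lpos i)
    \/ [/\ (h != i :> nat), (h != i.+1 :> nat) & tpos i h = h].
  have [->|hl] := eqVneq h (lpos i); first by left; rewrite tpos_l.
  have [->|hr] := eqVneq h (rpos i); first by right; left; rewrite tpos_r.
  by right; right; rewrite tpos_D //; move: hl hr; rewrite -!val_eqE.
have vl := val_lpos i; have vr := val_rpos i; move: ne.
case: (sE k) => [[-> ->]|[[-> ->]|[kl kr ->]]];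
case: (sE j) => [[-> ->]|[[-> ->]|[jl jr ->]]]; rewrite ?vl ?vr; lia.
Qed.

(** The added unit makes up for the ties: the last position wins all of them, and the first
    position, which would lose them, now holds a part larger by one. *)
Lemma rk_Phi0 z : rk (Phi_comp z) ord0 = rk z ord_max.
Proof.
rewrite /rk sum_rot' sum_rot /above !ltnn /= !add0n; apply: eq_bigr => i _.
by rewrite Phi_comp0 Phi_comp_r /= orbF ltn_ord [(n < i)%N]ltnNge (ltnW (ltn_ord i)).
Qed.

Lemma rk_PhiS z i : rk (Phi_comp z) (rpos i) = rk z (lpos i).
Proof.
rewrite /rk sum_rot' sum_rot /above; congr (_ + _)%N.
  by rewrite Phi_comp0 Phi_comp_r /= ltn_ord [(n < i)%N]ltnNge (ltnW (ltn_ord i)) orbF ltnS.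
by apply: eq_bigr => j _; rewrite !Phi_comp_r.
Qed.

Lemma rk_const0 k : rk (0%MM : 'X_{1..n.+1}) k = (n - k)%N.
Proof.
rewrite /rk (eq_bigr (fun j : 'I_n.+1 => (k < j)%N : nat)) => [|j _]; last first.
  by rewrite /above !mnm0E ltnn leqnn andbT andbF orbF.
rewrite -(big_mkord xpredT (fun j => (k < j)%N : nat)).
rewrite (@big_cat_nat _ _ _ k.+1) //= big_nat big1 ?add0n => [|j /andP[_ jk]]; last first.
  by rewrite ltnNge -ltnS jk.
rewrite big_nat (eq_bigr (fun=> 1%N)) => [|j /andP[kj _]]; last by rewrite kj.
by rewrite -big_nat sum_nat_const_nat muln1 subSS.
Qed.

Section OmegaMonomials.
Variables (K : fieldType) (q : K).
Local Notation P := {mpoly K[n.+1]}.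
Implicit Types p : P.

Lemma omega_Xrot z : omega q 'X_[rot_comp z] = q ^+ z ord_max *: 'X_[z] :> P.
Proof.
rewrite /omega comp_mpolyX big_ord_recl tnth_mktuple eqxx rot_comp0.
rewrite [in RHS]mpolyXE_id [in RHS]big_ord_recr /= exprZn -scalerAl mulrC.
congr (_ *: (_ * _)); apply: eq_bigr => i _.
rewrite tnth_mktuple -[lift ord0 i]/(rpos i) (negPf (rpos_neq0 i)).
by rewrite ord_pred_rpos rot_comp_r.
Qed.

#[local] Opaque omega omega_inv.

Lemma omega_coef p m : (omega q p)@_m = q ^+ m ord_max * p@_(rot_comp m).
Proof.
rewrite {1}[p]mpolyE omega_sum raddf_sum /= -(sum_msupp_delta p (rot_comp m)) mulr_sumr.
apply: eq_bigr => z _; rewrite omegaZ mcoeffZ -{2}[z]unrot_compK omega_Xrot.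
rewrite mcoeffZ mcoeffX mulrCA -(inj_eq (can_inj rot_compK)) unrot_compK.
by case: eqP => [->|_]; rewrite ?rot_compK // !mulr0.
Qed.

Hypothesis q_neq0 : q != 0.

Lemma omega_inv_coef p m :
  (omega_inv q p)@_(rot_comp m) = q ^- m ord_max * p@_m.
Proof.
rewrite -{2}[p](omega_invK q_neq0) omega_coef mulrA mulVf ?mul1r //.
by rewrite expf_neq0.
Qed.

Lemma Phi_coef p m : (Phi q p)@_(Phi_comp m) = q ^- m ord_max * p@_m.
Proof. by rewrite /Phi mulrC mcoeffMX omega_inv_coef. Qed.

Lemma Phi_supp p m : (Phi q p)@_m != 0 -> exists z, m = Phi_comp z.
Proof.
rewrite -mcoeff_msupp /Phi mulrC (perm_mem (msuppMX _ _)) => /mapP[z _ ->].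
by exists (unrot_comp z); rewrite /Phi_comp unrot_compK.
Qed.

Lemma Phi_lead p z : lead_at p z -> lead_at (q ^+ z ord_max *: Phi q p) (Phi_comp z).
Proof.
case=> pz pm; split=> [|m mz].
  by rewrite mcoeffZ Phi_coef pz mulr1 mulfV // expf_neq0.
rewrite mcoeffZ mulf_eq0 negb_or => /andP[_ Pm].
have [w ew] := Phi_supp Pm; move: mz Pm.
rewrite ew (inj_eq Phi_comp_inj) Phi_coef !len_Phi mulf_eq0 negb_or => wz /andP[_].
exact: pm.
Qed.

End OmegaMonomials.
End Rotation.

(** * Specialization at q = 1 *)

Section Specialization.
Variables (F L : fieldType) (phi : {rmorphism {poly F} -> L}).
Hypothesis phi_inj : injective phi.
Local Notation "x %:f" := (phi x) (at level 2, left associativity, format "x %:f").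

(* [r] is regular at [q = 1], with value [s]. *)
Definition spec (r : L) (s : F) : Prop :=
  exists a b : {poly F}, [/\ b.[1] != 0, r * b%:f = a%:f & s * b.[1] = a.[1]].

Lemma phi_eq0 a : (a%:f == 0) = (a == 0).
Proof. by rewrite -(rmorph0 phi) (inj_eq phi_inj). Qed.

Lemma spec_poly (a : {poly F}) : spec a%:f a.[1].
Proof.
have h1 : (1 : {poly F}).[1] = 1 by rewrite -[1 in X in X.[_]]polyC1 hornerC.
by exists a, 1; split; rewrite ?h1 ?oner_neq0 ?rmorph1 ?mulr1.
Qed.

Lemma spec0 : spec 0 0.
Proof. by have := spec_poly 0; rewrite rmorph0 horner0. Qed.

Lemma spec1 : spec 1 1.
Proof. by have := spec_poly 1%:P; rewrite polyC1 rmorph1 -[1 in X in X.[_]]polyC1 hornerC. Qed.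

Lemma specD r s r' s' : spec r s -> spec r' s' -> spec (r + r') (s + s').
Proof.
case=> a [b [b1 e f]] [a' [b' [b1' e' f']]]; exists (a * b' + a' * b), (b * b').
rewrite hornerM mulf_neq0 // rmorphD !rmorphM -e -e' hornerD !hornerM -f -f'.
by split=> //; ring.
Qed.

Lemma specN r s : spec r s -> spec (- r) (- s).
Proof.
case=> a [b [b1 e f]]; exists (- a), b.
by rewrite b1 !mulNr e f hornerN rmorphN.
Qed.

Lemma specB r s r' s' : spec r s -> spec r' s' -> spec (r - r') (s - s').
Proof. by move=> rs rs'; apply: specD => //; apply: specN. Qed.

Lemma specM r s r' s' : spec r s -> spec r' s' -> spec (r * r') (s * s').
Proof.
case=> a [b [b1 e f]] [a' [b' [b1' e' f']]]; exists (a * a'), (b * b').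
by rewrite !hornerM mulf_neq0 // !rmorphM -e -e' -f -f'; split=> //; ring.
Qed.

Lemma specV r s : spec r s -> s != 0 -> spec r^-1 s^-1.
Proof.
case=> a [b [b1 e f]] s0.
have a1 : a.[1] != 0 by rewrite -f mulf_neq0.
have a0 : a != 0 by apply: contraNneq a1 => ->; rewrite horner0.
have r0 : r != 0.
  by apply: contraNneq a0 => r0; rewrite -phi_eq0 -e r0 mul0r.
exists b, a; split=> //.
  by rewrite -e mulrA mulVf // mul1r.
by rewrite -f mulrA mulVf // mul1r.
Qed.

Lemma specX r s k : spec r s -> spec (r ^+ k) (s ^+ k).
Proof.
move=> rs; elim: k => [|k IH]; first exact: spec1.
by rewrite !exprS; apply: specM.
Qed.

(** This makes the value well defined, and it lets a nonzero value certify that the element itself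
    is nonzero. *)
Lemma spec_0 s : spec 0 s -> s = 0.
Proof.
case=> a [b [b1]]; rewrite mul0r => /esym/eqP; rewrite phi_eq0 => /eqP -> /eqP.
by rewrite horner0 mulf_eq0 (negPf b1) orbF => /eqP.
Qed.

Section Multivariate.
Variable n : nat.
Variables (q t : L) (t1 : F).
Hypotheses (q_neq0 : q != 0) (spec_q : spec q 1) (spec_t : spec t t1).
Implicit Types (m : 'X_{1..n.+1}).

Definition mspec (p : {mpoly L[n.+1]}) (p' : {mpoly F[n.+1]}) : Prop := forall m, spec p@_m p'@_m.

Lemma mspecD p p' r r' : mspec p p' -> mspec r r' -> mspec (p + r) (p' + r').
Proof. by move=> pp rr m; rewrite !mcoeffD; apply: specD. Qed.

Lemma mspecB p p' r r' : mspec p p' -> mspec r r' -> mspec (p - r) (p' - r').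
Proof. by move=> pp rr m; rewrite !mcoeffB; apply: specB. Qed.

Lemma mspecZ c c' p p' : spec c c' -> mspec p p' -> mspec (c *: p) (c' *: p').
Proof. by move=> cc pp m; rewrite !mcoeffZ; apply: specM. Qed.

Lemma mspecXm z : mspec 'X_[z] 'X_[z].
Proof. by move=> m; rewrite !mcoeffX; case: eqP => _; [apply: spec1|apply: spec0]. Qed.

Lemma mspec1 : mspec 1 1.
Proof. by rewrite -!mpolyX0; apply: mspecXm. Qed.

Lemma mspec0 : mspec 0 0.
Proof. by move=> m; rewrite !mcoeff0; apply: spec0. Qed.

Lemma mspec_sum (I : Type) (l : seq I) (Q : pred I) G G' :
  (forall x, Q x -> mspec (G x) (G' x)) ->
  mspec (\sum_(x <- l | Q x) G x) (\sum_(x <- l | Q x) G' x).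
Proof.
move=> GG'; apply: (big_ind2 mspec) => //; first exact: mspec0.
by move=> *; apply: mspecD.
Qed.

(** Specialization may shrink the support but not enlarge it, so [p] and [p'] can be expanded over
    the same monomials and compared term by term. *)
Lemma mspec_expand p p' : mspec p p' -> p' = \sum_(m <- msupp p) p'@_m *: 'X_[m].
Proof.
move=> pp; apply/mpolyP => m; rewrite raddf_sum /=.
under eq_bigr => z _ do rewrite mcoeffZ mcoeffX.
have [mp|] := boolP (m \in msupp p).
  rewrite (bigD1_seq m) ?msupp_uniq //= eqxx mulr1 big1 ?addr0 // => z /negPf ->.
  by rewrite mulr0.
rewrite -mcoeff_eq0 => /eqP pm; have := pp m; rewrite pm => /spec_0 ->.
rewrite big_seq big1 // => z zp; case: eqP => [e|_]; last by rewrite mulr0.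
by move: zp; rewrite e mcoeff_msupp pm eqxx.
Qed.

(** On monomials [T_i] has entries that are polynomial in [t], so applying it creates no pole. *)
Lemma mspec_opT i p p' : mspec p p' -> mspec (opT t i p) (opT t1 i p').
Proof.
move=> pp; rewrite [p]mpolyE (mspec_expand pp) !opT_sum.
apply: mspec_sum => m _; rewrite !opTZ; apply: mspecZ; first exact: pp.
have s1t : spec (1 - t) (1 - t1) by apply: specB; [apply: spec1|apply: spec_t].
have gt (z : 'X_{1..n.+1}) : (z (rpos i) < z (lpos i))%N ->
    mspec (opT t i 'X_[z]) (opT t1 i 'X_[z]).
  move=> lt_rl; rewrite !opT_X_gt //; apply: mspecD; first exact: mspecXm.
  by apply: mspecZ => //; apply: mspec_sum => d _; apply: mspecXm.
have [lt_rl|lt_lr|e] := ltngtP (m (rpos i)) (m (lpos i)).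
- exact: gt.
- rewrite (opT_X_lt t lt_lr) (opT_X_lt t1 lt_lr); apply: mspecB; last first.
    by apply: gt; rewrite swap_comp_l swap_comp_r.
  by apply: mspecZ; [exact: spec_t|apply: mspecD; apply: mspecXm].
- rewrite !opT_X_eq //; apply: mspecZ; [exact: spec_t|exact: mspecXm].
Qed.

Lemma mspec_omega p p' : mspec p p' -> mspec (omega q p) (omega 1 p').
Proof.
by move=> pp m; rewrite !omega_coef; apply: specM => //; apply: specX; apply: spec_q.
Qed.

Lemma mspec_Phi p p' : mspec p p' -> mspec (Phi q p) (Phi 1 p').
Proof.
have o0 := oner_neq0 F.
move=> pp m; have [m0|m0] := eqVneq (m ord0) 0%N.
  have nPhi (K : fieldType) (c : K) (r : {mpoly K[n.+1]}) : (Phi c r)@_m = 0.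
    apply/eqP; apply: contraT => /Phi_supp[z em].
    by move: m0; rewrite em Phi_comp0.
  by rewrite !nPhi; apply: spec0.
have -> : m = Phi_comp (unrot_comp (m - U_(ord0))).
  by rewrite /Phi_comp unrot_compK addmC submK // lep1mP.
rewrite !Phi_coef //; apply: specM => //; apply: specV.
  by apply: specX; apply: spec_q.
by rewrite expr1n.
Qed.

End Multivariate.
End Specialization.

(** * Specialization in the concrete field of rational functions *)

Section SpecializationQqt.
Local Notation "x %:F" := (FracField.tofrac x).
Local Open Scope quotient_scope.

Definition fracq : {rmorphism {poly Qt} -> Qqt} := @FracField.tofrac {poly Qt}.

Definition t1 : Qt := 'X%:F.

Lemma frac_numden (R : idomainType) (r : {fraction R}) :
  r * (\d_(repr r))%:F = (\n_(repr r))%:F.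
Proof.
rewrite -{1}[r]reprK !piE; apply/eqmodP; rewrite /= FracField.equivfE /=.
rewrite /FracField.mulf !numden_Ratio ?oner_neq0 ?mulr1 ?denom_ratioP //.
by rewrite mulrC.
Qed.

(** [spec] allows any denominator that does not vanish at 1, while [at_q1] uses the reduced one. By
    coprimality the reduced denominator divides the other, hence does not vanish at 1 either. *)
Lemma spec_at (r : Qqt) (s : Qt) :
  spec fracq r s -> regular_q1 r /\ at_q1 r = s.
Proof.
case=> a [b [b1 rb sb]]; rewrite /fracq /= in rb.
set nr := \n_(repr r); set dr := \d_(repr r).
have dr0 : dr != 0 by apply: denom_ratioP.
pose g := gcdp nr dr.
have g0 : g != 0 by rewrite gcdp_eq0 negb_and dr0 orbT.
have En : nr = rednum r * g by rewrite /rednum divpK // dvdp_gcdl.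
have Ed : dr = redden r * g by rewrite /redden divpK // dvdp_gcdr.
have cop : coprimep (rednum r) (redden r).
  by apply: coprimep_div_gcd; rewrite -/dr dr0 orbT.
have e : rednum r * b = a * redden r.
  apply: (mulIf g0); rewrite mulrAC -En -mulrA -Ed; apply/eqP.
  rewrite -tofrac_eq !tofracM -rb -(frac_numden r) -/dr.
  by apply/eqP; rewrite mulrAC.
have reg : regular_q1 r.
  apply: contraNneq b1 => d1.
  have : redden r %| b.
    rewrite -(Gauss_dvdpr _ (q := rednum r)); first by rewrite e dvdp_mulIr.
    by rewrite coprimep_sym.
  by case/dvdpP => c ->; rewrite hornerM d1 mulr0.
split=> //; rewrite /at_q1; apply: (mulIf b1); rewrite sb.
apply: (mulIf reg); rewrite mulrAC divfK //.
by rewrite -!hornerM e.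
Qed.

Lemma t1_neq0 : t1 != 0.
Proof. by rewrite tofrac_eq0 polyX_eq0. Qed.

Lemma t1_inj : injective (fun k => t1 ^+ k).
Proof.
move=> j k /eqP; rewrite -!tofracXn tofrac_eq => /eqP/(congr1 (size \o val)) /=.
by rewrite !size_polyXn => -[].
Qed.

Lemma tvar_neq0 : tvar != 0.
Proof. by rewrite tofrac_eq0 polyC_eq0 t1_neq0. Qed.

Lemma qvar_neq0 : qvar != 0.
Proof. by rewrite tofrac_eq0 polyX_eq0. Qed.

(** Clearing the powers of the constant [u] leaves a comparison of degrees in [X]. For [X = q] and
    [u = t] this recovers a part of a composition from its eigenvalue. *)
Lemma frac_monomial_inj (F : fieldType) (u : F) a b c d : u != 0 ->
  'X%:F ^+ a * u%:P%:F ^- b = 'X%:F ^+ c * u%:P%:F ^- d -> a = c.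
Proof.
move=> u0 e; have t0 k : u%:P%:F ^+ k != 0 by rewrite expf_neq0 // tofrac_eq0 polyC_eq0.
have : 'X%:F ^+ a * u%:P%:F ^+ d = 'X%:F ^+ c * u%:P%:F ^+ b.
  by rewrite -['X%:F ^+ a](mulfVK (t0 b)) e -!mulrA [u%:P%:F ^- d * _]mulrC mulfK.
move/eqP; rewrite -!tofracXn -!tofracM tofrac_eq -!polyC_exp => /eqP.
have s k h : size ('X^k * (u ^+ h)%:P) = k.+1.
  by rewrite mulrC mul_polyC size_scale ?size_polyXn // expf_neq0.
by move/(congr1 (fun p : {poly F} => size p)); rewrite !s => -[].
Qed.

Lemma qt_monomial_inj a b c d :
  qvar ^+ a * tvar ^- b = qvar ^+ c * tvar ^- d -> a = c.
Proof. exact: (frac_monomial_inj t1_neq0). Qed.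

Lemma fracq_inj : injective fracq.
Proof. by move=> a b /eqP; rewrite tofrac_eq => /eqP. Qed.

Lemma spec_q : spec fracq qvar 1.
Proof. by have := spec_poly fracq 'X; rewrite hornerX. Qed.

Lemma spec_t : spec fracq tvar t1.
Proof. by have := spec_poly fracq t1%:P; rewrite hornerC. Qed.

Lemma mspec_at n (p : {mpoly Qqt[n.+1]}) (p' : {mpoly Qt[n.+1]}) :
  mspec fracq p p' ->
  mregular_q1 p /\ mat_q1 p = p'.
Proof.
move=> pp; split=> [m|]; first by case: (spec_at (pp m)).
rewrite (mspec_expand fracq_inj pp).
by apply: eq_bigr => m _; have [_ ->] := spec_at (pp m).
Qed.

End SpecializationQqt.

(** * Nonsymmetric eigenvectors regular at q = 1 *)

Section Eigenvectors.
Variables (F L : fieldType) (phi : {rmorphism {poly F} -> L}).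
Hypothesis phi_inj : injective phi.
Variables (q t : L) (t1 : F) (n : nat).
Hypotheses (q_neq0 : q != 0) (t_neq0 : t != 0) (t1_neq0 : t1 != 0).
Hypotheses (spec_q : spec phi q 1) (spec_t : spec phi t t1).
Hypothesis t1_inj : injective (fun k => t1 ^+ k).
Hypothesis qt_inj : forall a b c d, q ^+ a * t ^- b = q ^+ c * t ^- d -> a = c.
Local Notation P := {mpoly L[n.+1]}.
Implicit Types (z m : 'X_{1..n.+1}) (i : 'I_n) (k : 'I_n.+1) (e p : P).
Local Notation Y := (opY q t).
Local Notation T := (opT t).

#[local] Opaque swap_var opT opTinv omega omega_inv opY.

Definition eigvec z p : Prop := forall k, Y k p = eigval q t k z *: p.

Definition good z e : Prop :=
  [/\ exists e' : {mpoly F[n.+1]}, mspec phi e e', eigvec z e & lead_at e z].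

Lemma opY_Z k c p : Y k (c *: p) = c *: Y k p.
Proof.
have Y0 : Y k 0 = 0.
  by have := opY_linear q t_neq0 k (-1) 0 0; rewrite scaler0 addr0 scaleN1r addNr.
by rewrite -[c *: p]addr0 opY_linear // Y0 addr0.
Qed.

Lemma opY_D k p p' : Y k (p + p') = Y k p + Y k p'.
Proof. by rewrite -[p]scale1r opY_linear // !scale1r. Qed.

Lemma good0 : good 0%MM 1.
Proof.
split; first by exists 1; apply: mspec1.
  by move=> k; rewrite opY1 // eigvalE mnm0E expr0 mul1r rk_const0.
split=> [|m m0]; first by rewrite mcoeff1 eqxx.
by rewrite mcoeff1 (negPf m0) eqxx.
Qed.

Lemma spec_eigval z k : spec phi (eigval q t k z) (t1 ^- rk z k).
Proof.
have := specM (specX (z k) spec_q) (specV phi_inj (specX (rk z k) spec_t) _).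
by rewrite expr1n mul1r eigvalE; apply; rewrite expf_neq0.
Qed.

Lemma spec_neq0 r s : spec phi r s -> s != 0 -> r != 0.
Proof. by move=> rs; apply: contraNneq => r0; move: rs; rewrite r0 => /(spec_0 phi_inj) ->. Qed.

(** With [a], [b] the eigenvalues of [z] at positions [i] and [i+1], this is the solution [c] of
    [c (b - a) = b (1 - t)], the condition for [T_i e + c e] to have eigenvalue [b] under [Y_i]. *)
Definition intertw z i : L :=
  (1 - t) * eigval q t (rpos i) z / (eigval q t (rpos i) z - eigval q t (lpos i) z).

(* At [q = 1] the eigenvalues of [z] are distinct powers of [t], so the
   intertwining coefficients have no pole there. *)
Lemma eigval_diff z i :
  t1 ^- rk z (rpos i) - t1 ^- rk z (lpos i) != 0.
Proof.
rewrite subr_eq0; apply/eqP => /invr_inj/t1_inj/rk_inj/eqP.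
by rewrite eq_sym (negPf (lpos_neq_rpos i)).
Qed.

Lemma spec_intertw z i : exists c, spec phi (intertw z i) c.
Proof.
eexists; apply: specM; last first.
  by apply: (specV phi_inj); [apply: specB; exact: spec_eigval|exact: eigval_diff].
apply: specM; last exact: spec_eigval.
by apply: specB; [exact: spec1|exact: spec_t].
Qed.

Lemma eigval_swap z i k : z (lpos i) != z (rpos i) ->
  eigval q t k (swap_comp i z) = eigval q t (tpos i k) z.
Proof. by move=> ne; rewrite !eigvalE rk_swap // swap_compE. Qed.

(** The relation [T_i Y_i T_i = t Y_(i+1)] and the quadratic relation give [Y_i] and [Y_(i+1)] on
    [T_i e] as combinations of [T_i e] and [e]; adding [c e] removes the unwanted [e]. The other
    [Y_k] commute with [T_i]. *)
Lemma good_swap z e i : (z (rpos i) < z (lpos i))%N -> good z e ->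
  good (swap_comp i z) (T i e + intertw z i *: e).
Proof.
move=> lt_rl [[e' ee'] Ye lead]; have ne : z (lpos i) != z (rpos i) by rewrite gtn_eqF.
split.
- have [c cc] := spec_intertw z i; exists (opT t1 i e' + c *: e').
  by apply: mspecD; [exact: (mspec_opT phi_inj spec_t)|exact: mspecZ].
- have [a ea] : {a | a = eigval q t (lpos i) z} by exists (eigval q t (lpos i) z).
  have [b eb] : {b | b = eigval q t (rpos i) z} by exists (eigval q t (rpos i) z).
  have Ya : Y (lpos i) e = a *: e by rewrite Ye ea.
  have Yb : Y (rpos i) e = b *: e by rewrite Ye eb.
  have ba0 : b - a != 0.
    rewrite ea eb; apply: spec_neq0 (eigval_diff z i).
    by apply: specB; apply: spec_eigval.
  have : intertw z i * (b - a) = b * (1 - t).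
    by rewrite /intertw -ea -eb divfK // mulrC.
  move: (intertw z i) => c ec.
  have YlT : Y (lpos i) (T i e) = b *: (T i e - (t - 1) *: e).
    have := opY_succ q t_neq0 i e; rewrite Yb scalerA => /(congr1 (opTinv t i)).
    rewrite opTK // => ->; rewrite opTinvE // opTZ -!mul_mpolyC mpolyCM.
    have := congr1 (@mpolyC n.+1 L) (mulVf t_neq0); rewrite mpolyCM mpolyC1.
    move: (t^-1)%:MP (t - 1)%:MP t%:MP b%:MP (T i e) => u v w b' f uw.
    by apply: (lin_comb2 (c1 := b' * (f - v * e)) (c2 := 0) uw (erefl 0)); ring.
  have YrT : Y (rpos i) (T i e) = a *: T i e + ((t - 1) * b) *: e.
    have := opY_succ q t_neq0 i (T i e).
    have YlT' : Y (lpos i) (T i e) = b *: T i e + (b * (1 - t)) *: e.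
      by rewrite YlT scalerBr scalerA -scaleNr -mulrN opprB.
    rewrite opT_quadratic opY_D !opY_Z YlT' Ya !opTD !opTZ !opTD !opTZ.
    rewrite opT_quadratic => h; apply: (scalerI t_neq0); rewrite -h.
    rewrite -!mul_mpolyC !(mpolyCM, mpolyCB, mpolyCN, mpolyC1).
    by move: t%:MP b%:MP a%:MP (T i e) => t' b' a' f; ring.
  move=> k; rewrite eigval_swap // opY_D opY_Z.
  have ecP := congr1 (@mpolyC n.+1 L) ec; rewrite !(mpolyCM, mpolyCB, mpolyC1) in ecP.
  have [->|kl] := eqVneq k (lpos i).
    rewrite tpos_l -eb YlT Ya -!mul_mpolyC mpolyCB mpolyC1.
    apply: (lin_comb2 (c1 := - e) (c2 := 0) ecP (erefl 0)).
    by move: t%:MP b%:MP a%:MP c%:MP (T i e) => t' b' a' c' f; ring.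
  have [->|kr] := eqVneq k (rpos i).
    rewrite tpos_r -ea YrT Yb -!mul_mpolyC mpolyCM mpolyCB mpolyC1.
    apply: (lin_comb2 (c1 := e) (c2 := 0) ecP (erefl 0)).
    by move: t%:MP b%:MP a%:MP c%:MP (T i e) => t' b' a' c' f; ring.
  rewrite tpos_D // -natT_ord opY_comm //; last first.
    by move: kl kr (ltn_ord i); rewrite -!val_eqE /= /bump; lia.
  by rewrite !natT_ord !Ye opTZ [RHS]scalerDr !scalerA [c * _]mulrC.
(* The correction [c e] has only monomials of length at most [len z], below the new leading one. *)
- have [lead1 lead2] := opT_lead t lt_rl lead; have [ez em] := lead.
  have ls := len_swap lt_rl.
  have e_le m : e@_m != 0 -> (len m <= len z)%N.
    by have [->//|mz] := eqVneq m z; move/(em _ mz)/ltnW.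
  split=> [|m ms].
    rewrite mcoeffD mcoeffZ lead1; have [->|/e_le] := eqVneq e@_(swap_comp i z) 0.
      by rewrite mulr0 addr0.
    by rewrite ls ltnn.
  rewrite mcoeffD mcoeffZ; have [->|em0] := eqVneq e@_m 0.
    by rewrite mulr0 addr0 => /(lead2 _ ms).
  by move=> _; rewrite ls ltnS; apply: e_le.
Qed.

Lemma PhiZ c p : Phi q (c *: p) = c *: Phi q p.
Proof. by rewrite /Phi omega_invZ -scalerAr. Qed.

(** The scalar restores leading coefficient 1, since the inverse shift multiplies [x^z] by [q] to
    the power minus the last part of [z]. *)
Lemma good_Phi z e : good z e -> good (Phi_comp z) (q ^+ z ord_max *: Phi q e).
Proof.
case=> [[e' ee'] Ye lead]; split; last exact: Phi_lead.
  exists (1 ^+ z ord_max *: Phi 1 e'); apply: mspecZ; first exact: specX.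
  exact: (mspec_Phi phi_inj q_neq0 spec_q).
move=> k; rewrite opY_Z scalerA [_ * q ^+ _]mulrC -scalerA; congr (_ *: _).
case: (ord0_or_rpos k) => [->|[i ->]].
  rewrite (opY0_Phi t_neq0 q_neq0) (Ye ord_max) PhiZ scalerA !eigvalE.
  by rewrite Phi_comp0 rk_Phi0 exprS mulrA.
by rewrite opYS_Phi // Ye PhiZ !eigvalE Phi_comp_r rk_PhiS.
Qed.

Lemma mdeg_swap i z : mdeg (swap_comp i z) = mdeg z.
Proof.
rewrite !mdegE (reindex_inj (@perm_inj _ (tpos i))) /=.
by apply: eq_bigr => k _; rewrite swap_compE tpermK.
Qed.

Lemma mdeg_Phi z : mdeg (Phi_comp z) = (mdeg z).+1.
Proof.
rewrite /Phi_comp mdegD mdeg1 add1n !mdegE sum_rot' sum_rot rot_comp0; congr (_ + _).+1.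
by apply: eq_bigr => i _; rewrite rot_comp_r.
Qed.

(** Induction on the degree and, within it, on the position of the first nonzero part. At position 0
    one unit of that part is produced by [Phi_comp]; otherwise the part is moved left past a zero,
    and [good_swap] moves it back. *)
Lemma exists_good z : exists e, good z e.
Proof.
move: {2}(mdeg z) (erefl (mdeg z)) => d; elim: d z => [|d IH] z ed.
  have -> : z = 0%MM by apply/eqP; rewrite -mdeg_eq0 ed.
  by exists 1; apply: good0.
have [j [zj0 jmin]] : exists j : nat, (exists2 k : 'I_n.+1, z k != 0%N & k = j :> nat)
    /\ forall k : 'I_n.+1, (k < j)%N -> z k = 0%N.
  have ex : exists j, has (fun k : 'I_n.+1 => (val k == j) && (z k != 0%N)) (enum 'I_n.+1).
    have /negP : mdeg z != 0%N by rewrite ed.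
    rewrite mdegE sum_nat_eq0 => /negP/forallPn[k]; rewrite implyTb => zk.
    by exists (val k); apply/hasP; exists k; rewrite ?mem_enum ?eqxx.
  case: (ex_minnP ex) => j /hasP[k _ /andP[/eqP kj zk]] jmin; exists j; split.
    by exists k.
  move=> k' lt_k'; apply/eqP; apply: contraLR lt_k' => zk'; rewrite -leqNgt.
  by apply: jmin; apply/hasP; exists k'; rewrite ?mem_enum ?eqxx.
elim: j z ed zj0 jmin => [|j IHj] z ed [k zk kj] jmin.
  have k0 : k = ord0 by apply: val_inj.
  have ez : z = Phi_comp (unrot_comp (z - U_(ord0))).
    by rewrite /Phi_comp unrot_compK addmC submK // lep1mP -k0.
  move: ed; rewrite ez mdeg_Phi => -[ed]; have [e ge] := IH _ ed.
  by exists (q ^+ (unrot_comp (z - U_(ord0))) ord_max *: Phi q e); apply: good_Phi.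
case: (ord0_or_rpos k) => [k0|[i ki]]; first by rewrite k0 in kj.
have ij : i = j :> nat by move: kj; rewrite ki val_rpos => -[].
have zl : z (lpos i) = 0%N by apply: jmin; rewrite val_lpos ij.
have [e ge] : exists e, good (swap_comp i z) e.
  apply: IHj; first by rewrite mdeg_swap.
    by exists (lpos i); rewrite ?swap_comp_l -?ki.
  move=> k' lt_k'.
  have kl : k' != lpos i by rewrite -val_eqE /= ij ltn_eqF.
  have kr : k' != rpos i by rewrite -val_eqE /= /bump leq0n add1n ij ltn_eqF // ltnW.
  by rewrite swap_comp_D // jmin // ltnW.
exists (T i e + intertw (swap_comp i z) i *: e).
rewrite -[z in good z](swap_compK i); apply: good_swap => //.
by rewrite swap_comp_l swap_comp_r zl lt0n -ki.
Qed.

Lemma eigval_inj z m : (forall k, eigval q t k z = eigval q t k m) -> z = m.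
Proof. by move=> h; apply/mnmP => k; have := h k; rewrite !eigvalE => /qt_inj. Qed.

Section Uniqueness.
Variables (lam : 'X_{1..n.+1}) (e0 : P).
Hypothesis good_e0 : good lam e0.

(** Labelled sums of eigenvectors, in which labels may repeat. The condition on the label [lam]
    holds by construction of the terms, and makes what survives the elimination in [eigvec_uniq] a
    multiple of [e0]. *)
Definition eigsum p : Prop := exists s : seq ('X_{1..n.+1} * P),
  (forall x, x \in s -> eigvec x.1 x.2 /\ (x.1 = lam -> exists c, x.2 = c *: e0))
  /\ p = \sum_(x <- s) x.2.

Lemma eigvecZ z c p : eigvec z p -> eigvec z (c *: p).
Proof. by move=> Yp k; rewrite opY_Z Yp !scalerA mulrC. Qed.

Lemma eigsumD p p' : eigsum p -> eigsum p' -> eigsum (p + p').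
Proof.
move=> [s [hs ->]] [s' [hs' ->]]; exists (s ++ s'); rewrite big_cat; split=> // x.
by rewrite mem_cat => /orP[/hs|/hs'].
Qed.

Lemma eigsumZ c p : eigsum p -> eigsum (c *: p).
Proof.
move=> [s [hs ->]]; exists [seq (x.1, c *: x.2) | x <- s].
rewrite big_map scaler_sumr; split=> // _ /mapP[x xs ->] /=.
have [Yx ex] := hs x xs; split; first exact: eigvecZ.
by move/ex => [c' ->]; exists (c * c'); rewrite scalerA.
Qed.

Lemma eigsum0 : eigsum 0.
Proof. by exists [::]; rewrite big_nil. Qed.

(** Inversion of a unitriangular matrix: [x^z] is its eigenvector minus shorter monomials, which are
    handled by induction on [len]. *)
Lemma eigsumX z : eigsum 'X_[z].
Proof.
move: {2}(len z).+1 (ltnSn (len z)) => l; elim: l z => // l IH z; rewrite ltnS => lz.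
have [e [ge he]] : exists e, good z e /\ (z = lam -> exists c, e = c *: e0).
  have [->|zl] := eqVneq z lam; first by exists e0; split=> // _; exists 1; rewrite scale1r.
  by have [e ge] := exists_good z; exists e; split=> // ez; rewrite ez eqxx in zl.
have [_ Ye [ez em]] := ge.
have -> : 'X_[z] = e - \sum_(m <- msupp e | m != z) e@_m *: 'X_[m].
  rewrite {1}[e]mpolyE (bigD1_seq z) ?msupp_uniq ?mcoeff_msupp ?ez ?oner_neq0 //=.
  by rewrite scale1r addrK.
apply: eigsumD; first by exists [:: (z, e)]; rewrite big_seq1; split=> // x; rewrite inE => /eqP ->.
rewrite -scaleN1r; apply: eigsumZ; rewrite big_seq_cond.
apply: (big_ind eigsum); [exact: eigsum0|exact: eigsumD|].
move=> m; rewrite mcoeff_msupp => /andP[e_m mz]; apply: eigsumZ; apply: IH.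
exact: leq_trans (em _ mz e_m) lz.
Qed.

Lemma eigsum_all p : eigsum p.
Proof.
rewrite [p]mpolyE; apply: (big_ind eigsum); [exact: eigsum0|exact: eigsumD|].
by move=> m _; apply: eigsumZ; apply: eigsumX.
Qed.

(** Induction on the number of eigenvectors summing to [p]. A term labelled [lam] is subtracted; a
    term with another label is annihilated by an operator that fixes [p]. *)
Lemma eigvec_uniq p : eigvec lam p -> exists c, p = c *: e0.
Proof.
have [s [hs ep]] := eigsum_all p; move: {2}(size s) (erefl (size s)) => l es.
elim: l s p es hs ep => [|l IH] [|[z e] s] p //= => [_ _ ->|[es] hs ep] Yp.
  by exists 0; rewrite big_nil scale0r.
move: ep; rewrite big_cons /= => ep.
have [Ye ee] := hs (z, e) (mem_head _ _).
have hs' x : x \in s -> eigvec x.1 x.2 /\ (x.1 = lam -> exists c, x.2 = c *: e0).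
  by move=> xs; apply: hs; rewrite inE xs orbT.
have [ez|zl] := eqVneq z lam.
  have [c ec] := ee ez; have [||c' ec'] := IH s (p - e) es hs' _ _.
  - by rewrite ep addrAC subrr add0r.
  - move=> k; rewrite opY_D -scaleN1r opY_Z Yp Ye /= ez.
    by rewrite scalerDr !scalerA mulN1r mulrN1.
  by exists (c + c'); rewrite scalerDl -ec -ec' addrC subrK.
have [k yk] : exists k, eigval q t k lam != eigval q t k z.
  apply/existsP; rewrite -negb_forall; apply: contraNN zl => /forallP h.
  by apply/eqP; apply: eigval_inj => k; apply/esym/eqP/h.
pose y := eigval q t k; have y0 : y lam - y z != 0 by rewrite subr_eq0.
(* The operator [(Y_k - y z) / (y lam - y z)] fixes [p], kills the term labelled [z], and rescales
   every other term. *)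
pose s' := [seq (x.1, (y lam - y z)^-1 *: (Y k x.2 - y z *: x.2)) | x <- s].
apply: (IH s' p) => //; first by rewrite size_map.
  move=> _ /mapP[x xs ->] /=; have [Yx ex] := hs' x xs.
  rewrite Yx -scalerBl scalerA; split; first exact: eigvecZ.
  by move/ex => [c ->]; eexists; rewrite scalerA.
rewrite big_map /=; set c := _^-1.
have Ysum r : \sum_(x <- r) c *: (Y k x.2 - y z *: x.2)
    = c *: (Y k (\sum_(x <- r) x.2) - y z *: \sum_(x <- r) x.2).
  elim: r => [|x r IHr]; last first.
    by rewrite !big_cons IHr opY_D -[LHS]scalerDr [y z *: (_ + _)]scalerDr opprD addrACA.
  rewrite !big_nil scaler0 subr0.
  by have := opY_Z k 0 0; rewrite !scale0r => ->; rewrite scaler0.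
rewrite Ysum; have -> : \sum_(x <- s) x.2 = p - e by rewrite ep addrAC subrr add0r.
rewrite opY_D -scaleN1r opY_Z Yp Ye /= -/(y _) -/(y _).
apply: (scalerI y0); rewrite [RHS]scalerA mulfV // scale1r.
rewrite -!mul_mpolyC !(mpolyCB, mpolyCN, mpolyC1).
by move: (y lam)%:MP (y z)%:MP => u v; ring.
Qed.

Lemma eigvec_lead p : eigvec lam p -> p@_lam = 1 -> p = e0.
Proof.
move=> /eigvec_uniq[c ->]; have [_ _ [el _]] := good_e0.
by rewrite mcoeffZ el mulr1 => ->; rewrite scale1r.
Qed.

End Uniqueness.
End Eigenvectors.

(** * Families of exchange relations at q = 1 *)

Section Rearrangements.
Variable n : nat.
Implicit Types (z m lam : 'X_{1..n.+1}) (i : 'I_n) (k : 'I_n.+1).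

Lemma mem_rearr lam z :
  reflect (exists s : 'S_n.+1, forall k, z k = lam (s k)) (z \in rearr lam).
Proof.
rewrite mem_undup; apply: (iffP mapP) => [[s _ ->]|[s zs]].
  by exists s => k; rewrite mnmE.
by exists s; rewrite ?mem_enum //; apply/mnmP => k; rewrite mnmE.
Qed.

Lemma rearr_id lam : lam \in rearr lam.
Proof. by apply/mem_rearr; exists 1%g => k; rewrite perm1. Qed.

Lemma rearr_swap lam z i : z \in rearr lam -> swap_comp i z \in rearr lam.
Proof.
move=> /mem_rearr[s zs]; apply/mem_rearr; exists (tpos i * s)%g => k.
by rewrite swap_compE zs permM.
Qed.

Lemma rearr_rot lam z : z \in rearr lam -> rot_comp z \in rearr lam.
Proof.
move=> /mem_rearr[s zs]; apply/mem_rearr.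
have inj : injective (@ord_pred n.+1) by exact: can_inj (@ord_predK _).
by exists (perm inj * s)%g => k; rewrite permM permE mnmE zs.
Qed.

Lemma rearr_unrot lam z : z \in rearr lam -> unrot_comp z \in rearr lam.
Proof.
move=> /mem_rearr[s zs]; apply/mem_rearr.
have inj : injective (@ordS n.+1) by exact: can_inj (@ordSK _).
by exists (perm inj * s)%g => k; rewrite permM permE mnmE zs.
Qed.

Lemma rearr_count lam z c : z \in rearr lam ->
  #|[set k | (c <= z k)%N]| = #|[set k | (c <= lam k)%N]|.
Proof.
case/mem_rearr=> s zs; rewrite -(card_imset _ (@perm_inj _ s)); congr #|pred_of_set _|.
apply/setP => k; rewrite inE; apply/imsetP/idP => [[j + ->]|ck].
  by rewrite inE zs.
by exists (s^-1 k)%g; rewrite ?inE ?zs permKV.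
Qed.

Lemma perm_rearr_swap lam i : perm_eq (rearr lam) (map (@swap_comp n i) (rearr lam)).
Proof.
apply: uniq_perm; first exact: undup_uniq.
  by rewrite map_inj_uniq ?undup_uniq //; apply: can_inj (swap_compK i).
move=> z; apply/idP/mapP => [zl|[m ml ->]]; last exact: rearr_swap.
by exists (swap_comp i z); rewrite ?swap_compK //; apply: rearr_swap.
Qed.

Lemma perm_rearr_rot lam : perm_eq (rearr lam) (map (@rot_comp n) (rearr lam)).
Proof.
apply: uniq_perm; first exact: undup_uniq.
  by rewrite map_inj_uniq ?undup_uniq //; apply: can_inj (@rot_compK n).
move=> z; apply/idP/mapP => [zl|[m ml ->]]; last exact: rearr_rot.
by exists (unrot_comp z); rewrite ?unrot_compK //; apply: rearr_unrot.
Qed.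

End Rearrangements.

(** * Discordance between two compositions, and cyclic transport of a column *)

Section Discordance.
Variable n : nat.
Implicit Types (th z : 'X_{1..n.+1}) (i : 'I_n) (u v : 'I_n.+1).

(** An arc from [u] to [v] where [th] strictly prefers [u] and [z] does not. Absence of all arcs
    says exactly that [th] is a weakly increasing function of [z]. *)
Definition dis th z u v : bool := (th v < th u)%N && (z u <= z v)%N.
Definition disc th z : nat := (\sum_u \sum_v dis th z u v)%N.

Lemma disc_swap i th z : disc (swap_comp i th) (swap_comp i z) = disc th z.
Proof.
rewrite /disc [RHS](reindex_inj (@perm_inj _ (tpos i))) /=; apply: eq_bigr => u _.
rewrite [RHS](reindex_inj (@perm_inj _ (tpos i))) /=; apply: eq_bigr => v _.
by rewrite /dis !swap_compE.
Qed.

Lemma dis_rot th z u v :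
  dis (rot_comp th) (rot_comp z) u v = dis th z (ord_pred u) (ord_pred v).
Proof. by rewrite /dis !mnmE. Qed.

Lemma disc_rot th z : disc (rot_comp th) (rot_comp z) = disc th z.
Proof.
have inj : injective (@ord_pred n.+1) by exact: can_inj (@ord_predK _).
rewrite /disc [RHS](reindex_inj inj) /=; apply: eq_bigr => u _.
by rewrite [RHS](reindex_inj inj) /=; apply: eq_bigr => v _; rewrite dis_rot.
Qed.

(** A rearrangement inequality: against a third column [(e, f)], pairing the larger of [a], [b] with
    the larger of [c], [d] gives no more discordances than the crossed pairing. *)
Lemma dis_exchange (a b c d e f : nat) : (b < a)%N -> (d < c)%N ->
  (((e < a) && (c <= f)) + ((e < b) && (d <= f)) + ((a < e) && (f <= c))
     + ((b < e) && (f <= d))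
   <= ((e < a) && (d <= f)) + ((e < b) && (c <= f)) + ((a < e) && (f <= d))
     + ((b < e) && (f <= c)))%N.
Proof.
move=> ba dc; case: (ltnP e a); case: (ltnP e b); case: (ltnP a e); case: (ltnP b e);
case: (leqP c f); case: (leqP d f); case: (leqP f c); case: (leqP f d); lia.
Qed.

(** Crossing two concordant columns creates an arc between them, and by [dis_exchange] loses none in
    total against the other columns. *)
Lemma disc_lt_gt i th z : (th (rpos i) < th (lpos i))%N -> (z (rpos i) < z (lpos i))%N ->
  (disc th z < disc th (swap_comp i z))%N.
Proof.
move=> th_rl z_rl; rewrite /disc !(sum2_lr i).
rewrite /dis !ltnn !swap_comp_l !swap_comp_r /= th_rl [(th (lpos i) < _)%N]ltnNge.
rewrite (ltnW th_rl) (ltnW z_rl) [(z (lpos i) <= z (rpos i))%N]leqNgt z_rl /=.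
rewrite !addn0 !add0n -addSn; apply: leq_add; last first.
  apply: eq_leq; apply: eq_bigr => u /andP[ul ur]; apply: eq_bigr => v /andP[vl vr].
  by rewrite !swap_comp_D.
rewrite add1n ltnS; apply: leq_sum => k /andP[kl kr]; rewrite !swap_comp_D //.
exact: dis_exchange.
Qed.

Lemma disc_lt i th z :
  (th (rpos i) < th (lpos i))%N && (z (rpos i) < z (lpos i))%N
  || (th (lpos i) < th (rpos i))%N && (z (lpos i) < z (rpos i))%N ->
  (disc th z < disc th (swap_comp i z))%N.
Proof.
case/orP=> /andP[h1 h2]; first exact: disc_lt_gt.
have := @disc_lt_gt i (swap_comp i th) (swap_comp i z).
rewrite !swap_comp_l !swap_comp_r disc_swap => /(_ h1 h2).
by rewrite -(disc_swap i (swap_comp i th)) !swap_compK.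
Qed.

Lemma disc0P th z u v : disc th z = 0%N -> (th v < th u)%N -> (z v < z u)%N.
Proof.
move/eqP; rewrite sum_nat_eq0 => /forallP/(_ u); rewrite implyTb sum_nat_eq0.
move=> /forallP/(_ v); rewrite implyTb /dis => h th_vu; rewrite ltnNge.
by apply: contraTN h => zuv; rewrite th_vu zuv.
Qed.

(** Suppose [x u < y u]. Equally many positions carry a part at least [y u] in [x] and in [y], so
    some [w] has [x w >= y u > y w]. Then [x] forces [z u < z w] and [y] forces [z w < z u]. *)
Lemma disc0_inj mu th th' z : th \in rearr mu -> th' \in rearr mu ->
  disc th z = 0%N -> disc th' z = 0%N -> th = th'.
Proof.
have half x y u : x \in rearr mu -> y \in rearr mu -> disc x z = 0%N -> disc y z = 0%N ->
    (y u <= x u)%N.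
  move=> xm ym dx dy; rewrite leqNgt; apply/negP => lt_xy.
  have [w] : exists w, (w \in [set k | (y u <= x k)%N]) && (w \notin [set k | (y u <= y k)%N]).
    apply/existsP; apply: contraT; rewrite negb_exists => /forallP sub.
    have sUV : [set k | (y u <= x k)%N] \subset [set k | (y u <= y k)%N].
      by apply/subsetP => w; have := sub w; rewrite negb_and negbK => /orP[/negPf ->|].
    have : [set k | (y u <= x k)%N] == [set k | (y u <= y k)%N].
      by rewrite eqEcard sUV (rearr_count _ xm) (rearr_count _ ym) leqnn.
    by move/eqP/setP/(_ u); rewrite !inE leqnn leqNgt lt_xy.
  rewrite !inE -ltnNge => /andP[xw yw].
  have := disc0P dx (leq_trans lt_xy xw); have := disc0P dy yw.
  by move=> h1 h2; have := ltn_trans h1 h2; rewrite ltnn.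
by move=> tm t'm d d'; apply/mnmP => u; apply/eqP; rewrite eqn_leq !half.
Qed.

Lemma disc_bound th z : (disc th z <= n.+1 * n.+1)%N.
Proof.
rewrite /disc -[X in (_ <= X * _)%N](card_ord n.+1) -sum_nat_const.
apply: leq_sum => u _; rewrite -[X in (_ <= X)%N](card_ord n.+1) -sum1_card.
by apply: leq_sum => v _; apply: leq_b1.
Qed.

(* The composition [z] with its first entry moved to position [j]. *)
Definition shift z (j : nat) : 'X_{1..n.+1} :=
  [multinom (if k < j then z (ordS k) else if k == j :> nat then z ord0 else z k)%N
   | k < n.+1].

Lemma shift0 z : shift z 0 = z.
Proof.
apply/mnmP => k; rewrite mnmE /=; case: ifP => // /eqP k0.
by congr (z _); apply: val_inj.
Qed.

Lemma shift_l z i : shift z i (lpos i) = z ord0.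
Proof. by rewrite mnmE /= ltnn eqxx. Qed.
Lemma shift_r z i : shift z i (rpos i) = z (rpos i).
Proof. by rewrite mnmE val_rpos ltnNge leqnSn /= gtn_eqF. Qed.

Lemma shiftS z i : shift z i.+1 = swap_comp i (shift z i).
Proof.
apply/mnmP => k.
have [->|kl] := eqVneq k (lpos i).
  by rewrite swap_comp_l shift_r mnmE /= ltnSn ordS_lpos.
have [->|kr] := eqVneq k (rpos i).
  by rewrite swap_comp_r shift_l mnmE val_rpos ltnn eqxx.
rewrite swap_comp_D // !mnmE; move: kl kr; rewrite -!val_eqE /= /bump leq0n add1n.
move=> kl kr; rewrite ltnS leq_eqVlt (negPf kl) /= (negPf kr).
by case: ltnP => // _.
Qed.

Lemma rot_shift z : rot_comp (shift z n) = z.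
Proof.
apply/mnmP => k; case: (ord0_or_rpos k) => [->|[i ->]].
  by rewrite rot_comp0 mnmE /= ltnn eqxx.
by rewrite rot_comp_r mnmE /= ltn_ord ordS_lpos.
Qed.

End Discordance.

(** * Exchange families with zero sum vanish *)

Section UniquenessAtOne.
Variables (K : fieldType) (t : K) (n : nat).
Hypothesis t_neq0 : t != 0.
Hypothesis t_inj : injective (fun k => t ^+ k).
Variable mu : 'X_{1..n.+1}.
Implicit Types (th z : 'X_{1..n.+1}) (i : 'I_n) (u v : 'I_n.+1).
Local Notation P := {mpoly K[n.+1]}.
Local Notation T := (opT t).

#[local] Opaque swap_var opT opTinv omega omega_inv.

(** Purely linear conditions, so that families over the same [mu] can be subtracted and multiplied
    by symmetric polynomials. *)
Definition exchange_family (D : 'X_{1..n.+1} -> P) : Prop :=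
  forall th, th \in rearr mu ->
    [/\ forall i, (th (rpos i) < th (lpos i))%N -> T i (D th) = D (swap_comp i th),
        forall i, th (lpos i) = th (rpos i) -> T i (D th) = t *: D th
      & D th = omega 1 (D (rot_comp th))].

Variable D : 'X_{1..n.+1} -> P.
Hypothesis D_family : exchange_family D.
Local Notation a th z := ((D th)@_z).

Lemma coef_rot th z : th \in rearr mu -> a (rot_comp th) (rot_comp z) = a th z.
Proof.
by move=> th_mu; have [_ _ ->] := D_family th_mu; rewrite omega_coef expr1n mul1r.
Qed.

Section Level.
Variables N d : nat.
Hypothesis top : forall th z, th \in rearr mu -> (N < nrm z)%N -> a th z = 0.
Hypothesis low : forall th z, th \in rearr mu -> nrm z = N -> (d < disc th z)%N -> a th z = 0.

(** Here [N] is the top norm and [d] the top discordance at that norm. Exchanging two columns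
    changes the coefficient by [t] to the number of arcs from left to right minus the number from
    right to left; at most one of these is 1, and writing a power on each side avoids inverses. *)
Lemma coef_swap i th z : th \in rearr mu -> nrm z = N -> disc th z = d ->
  t ^+ dis th z (rpos i) (lpos i) * a (swap_comp i th) (swap_comp i z)
  = t ^+ dis th z (lpos i) (rpos i) * a th z.
Proof.
move=> th_mu zN dz; have top' x y : x \in rearr mu -> (nrm z < nrm y)%N -> a x y = 0.
  by move=> xm; rewrite zN => /top; apply.
have low' x : x \in rearr mu -> (d < disc x (swap_comp i z))%N -> a x (swap_comp i z) = 0.
  by move=> xm; apply: low => //; rewrite nrm_swap.
have [th_gt th_eq _] := D_family th_mu; rewrite /dis.
have [th_rl|th_lr|e] := ltngtP (th (rpos i)) (th (lpos i)) => /=.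
- rewrite expr0 mul1r -th_gt // opT_coef_top => [|m]; last first.
    by rewrite nrm_swap; apply: top'.
  rewrite swap_comp_l swap_comp_r swap_compK.
  have [z_lr|z_rl|e] := ltngtP (z (lpos i)) (z (rpos i)); rewrite ?expr1 //.
    rewrite expr0 mul1r low' ?mulr0 ?addr0 // -dz; apply: disc_lt.
    by rewrite th_rl z_rl.
  by rewrite swap_comp_id.
- have sth_mu := rearr_swap i th_mu; have [sth_gt _ _] := D_family sth_mu.
  have := sth_gt i; rewrite swap_comp_l swap_comp_r swap_compK => /(_ th_lr) eth.
  rewrite expr0 mul1r -eth opT_coef_top; last by move=> m; apply: top'.
  have [z_lr|z_rl|e] := ltngtP (z (lpos i)) (z (rpos i)); rewrite ?expr1 ?expr0 ?mul1r //.
    have -> : a (swap_comp i th) z = 0; last by rewrite mulr0 addr0.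
    apply: low => //; rewrite -dz -[disc (swap_comp i th) z](disc_swap i) swap_compK.
    by apply: disc_lt; rewrite th_lr z_lr orbT.
  by rewrite swap_comp_id.
- have -> : swap_comp i th = th by apply: swap_comp_id.
  rewrite !expr0 !mul1r; have := congr1 (mcoeff z) (th_eq i (esym e)).
  rewrite opT_coef_top => [|m]; last exact: top'.
  rewrite mcoeffZ; have [z_rl|z_lr|ez] := ltngtP (z (rpos i)) (z (lpos i)).
  + by move/(mulfI t_neq0).
  + move=> h; apply: (addIr ((t - 1) * a th z)); rewrite h; ring.
  + by rewrite swap_comp_id.
Qed.

(** The first column passes the next [j] columns one at a time; norm and discordance are preserved,
    so [coef_swap] applies at every step and the exponents add up. *)
Lemma coef_shift th z (j : nat) : th \in rearr mu -> nrm z = N -> disc th z = d ->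
  (j <= n)%N ->
  [/\ shift th j \in rearr mu, nrm (shift z j) = N, disc (shift th j) (shift z j) = d
    & t ^+ (\sum_(i < n | i < j) dis th z (rpos i) ord0)%N * a (shift th j) (shift z j)
      = t ^+ (\sum_(i < n | i < j) dis th z ord0 (rpos i))%N * a th z].
Proof.
move=> th_mu zN dz; elim: j => [|j IH] le_jn.
  by rewrite !shift0 !big_pred0.
have [sth sz sd e] := IH (ltnW le_jn); pose i := Ordinal le_jn.
have eS x : shift x j.+1 = swap_comp i (shift x j) by rewrite -shiftS.
rewrite !eS disc_swap nrm_swap; split=> //; first exact: rearr_swap.
have e' := coef_swap i sth sz sd.
have l x : shift x j (lpos i) = x ord0 by rewrite -(shift_l x i).
have r x : shift x j (rpos i) = x (rpos i) by rewrite -(shift_r x i).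
have sumS (F : 'I_n -> nat) :
    (\sum_(h < n | h < j.+1) F h = F i + \sum_(h < n | h < j) F h)%N.
  rewrite (bigD1 i) //=; congr (_ + _)%N; apply: eq_bigl => h.
  by rewrite -val_eqE /= ltnS; lia.
rewrite !sumS !exprD.
move: e'; rewrite /dis !l !r -!/(dis _ _ _ _) => e'.
by rewrite -mulrA mulrCA e' mulrCA e mulrA.
Qed.

(** After passing all columns, a rotation restores the original pair. The nonzero coefficient
    cancels, and distinctness of the powers of [t] equates the numbers of arcs into and out of the
    column. *)
Lemma column_balance0 th z : th \in rearr mu -> nrm z = N -> disc th z = d ->
  a th z != 0 -> (\sum_v dis th z v ord0 = \sum_v dis th z ord0 v)%N.
Proof.
move=> th_mu zN dz az; have [s1 s2 s3] := coef_shift th_mu zN dz (leqnn n).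
have full (F : 'I_n -> nat) : (\sum_(i < n | i < n) F i = \sum_(i < n) F i)%N.
  by apply: eq_bigl => i; rewrite ltn_ord.
rewrite -coef_rot // !rot_shift !full => /(mulIf az)/t_inj e.
by rewrite !sum_rot' /dis ltnn /= !add0n.
Qed.

(* Rotations bring any column to the first position. *)
Lemma column_balance u th z : th \in rearr mu -> nrm z = N -> disc th z = d ->
  a th z != 0 -> (\sum_v dis th z v u = \sum_v dis th z u v)%N.
Proof.
have inj : injective (@ordS n.+1) by exact: can_inj (@ordSK _).
(* Rotation relabels the arcs, so balance at [w] follows from balance of the rotated pair at the
   next position; the last position is followed by the first. *)
have step (w : 'I_n.+1) (x y : 'X_{1..n.+1}) : (\sum_v dis (rot_comp x) (rot_comp y) v (ordS w)
      = \sum_v dis (rot_comp x) (rot_comp y) (ordS w) v ->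
    \sum_v dis x y v w = \sum_v dis x y w v)%N.
  have E v v' : dis (rot_comp x) (rot_comp y) (ordS v) (ordS v') = dis x y v v'.
    by rewrite dis_rot !ordSK.
  move=> h; transitivity (\sum_v dis (rot_comp x) (rot_comp y) v (ordS w))%N.
    by rewrite [RHS](reindex_inj inj); apply: eq_bigr => v _; rewrite E.
  by rewrite h [LHS](reindex_inj inj); apply: eq_bigr => v _; rewrite E.
have rotP x y : x \in rearr mu -> nrm y = N -> disc x y = d -> a x y != 0 ->
    [/\ rot_comp x \in rearr mu, nrm (rot_comp y) = N, disc (rot_comp x) (rot_comp y) = d
      & a (rot_comp x) (rot_comp y) != 0].
  by move=> x_mu yN dy ay; rewrite rearr_rot // nrm_rot disc_rot coef_rot.
move: {2}(n - u)%N (leqnn (n - u)) => j; elim: j u th z => [|j IH] u th z le_uj.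
  move=> th_mu zN dz az; have [h1 h2 h3 h4] := rotP _ _ th_mu zN dz az; apply: step.
  have -> : ordS u = ord0; last exact: column_balance0.
  have -> : u = ord_max by apply: val_inj; have := ltn_ord u; rewrite /=; lia.
  by apply: val_inj; rewrite /= modnn.
move=> th_mu zN dz az; have [h1 h2 h3 h4] := rotP _ _ th_mu zN dz az; apply: step.
case: (ord_max_or_lpos u) => [->|[i ui]].
  have -> : ordS ord_max = ord0 :> 'I_n.+1 by apply: val_inj; rewrite /= modnn.
  exact: column_balance0.
by apply: IH => //; rewrite ui ordS_lpos val_rpos; move: le_uj; rewrite ui val_lpos; lia.
Qed.

(** Along an arc [th] strictly decreases. Among the positions with an outgoing arc take [w] with
    [th w] largest: by balance some arc enters [w], and its source has an outgoing arc and a larger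
    value of [th], which is impossible. *)
Lemma nonzero_disc0 th z : th \in rearr mu -> nrm z = N -> disc th z = d ->
  a th z != 0 -> disc th z = 0%N.
Proof.
move=> th_mu zN dz az; have bal u := column_balance u th_mu zN dz az.
pose p u := (\sum_v dis th z u v)%N.
rewrite /disc big1 // => u _; apply/eqP; apply: contraT; rewrite -lt0n -/(p u) => pu.
case: (@arg_maxnP _ u (fun v => 0 < p v)%N th pu) => w pw wmax.
have : (0 < \sum_v dis th z v w)%N by rewrite bal.
rewrite lt0n sum_nat_eq0 => /forallPn[v]; rewrite implyTb eqb0 negbK => dvw.
have : (0 < p v)%N by rewrite /p (bigD1 w) //= dvw.
move=> pv; have le_vw : (th v <= th w)%N := wmax v pv.
by case/andP: dvw; rewrite ltnNge le_vw.
Qed.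

End Level.

(** Descending induction on the discordance, starting from its bound: a nonzero coefficient of
    larger discordance would have discordance 0 by induction, so there is none, and this is the
    hypothesis [low] of the current level. *)
Lemma top_disc0 N : (forall th z, th \in rearr mu -> (N < nrm z)%N -> a th z = 0) ->
  forall th z, th \in rearr mu -> nrm z = N -> a th z != 0 -> disc th z = 0%N.
Proof.
move=> top; suff: forall k th z, th \in rearr mu -> nrm z = N ->
    (n.+1 * n.+1 <= disc th z + k)%N -> a th z != 0 -> disc th z = 0%N.
  by move=> h th z th_mu zN; apply: (h (n.+1 * n.+1)%N); rewrite ?leq_addl.
elim=> [|k IH] th z th_mu zN le_B az; apply: (nonzero_disc0 top _ th_mu zN (erefl _) az).
  by move=> x y _ _; have := disc_bound x y; lia.
move=> x y x_mu yN lt_d; apply/eqP; apply: contraT => axy.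
by have := IH x y x_mu yN _ axy; lia.
Qed.

(** Descending induction on the norm, from the largest one that occurs. At each norm, [disc0_inj]
    leaves at most one member of the family with a nonzero coefficient at [x^z], and the zero sum
    kills it. *)
Lemma exchange_family_eq0 :
  \sum_(th <- rearr mu) D th = 0 -> forall th, th \in rearr mu -> D th = 0.
Proof.
move=> sumD; pose M := (\max_(th <- rearr mu) \max_(z <- msupp (D th)) nrm z)%N.
suff: forall k th z, th \in rearr mu -> (M < nrm z + k)%N -> a th z = 0.
  move=> h th th_mu; apply/mpolyP => z; rewrite mcoeff0.
  by apply: (h M.+1) => //; rewrite addnS ltnS leq_addl.
elim=> [|k IH] th z th_mu.
  rewrite addn0 ltnNge => h; apply/eqP; apply: contraNT h; rewrite -mcoeff_msupp => zD.
  apply: leq_trans (leq_bigmax_seq _ th_mu isT).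
  exact: (leq_bigmax_seq _ zD isT).
move=> ltM; apply/eqP; apply: contraT => az.
have top x y : x \in rearr mu -> (nrm z < nrm y)%N -> a x y = 0.
  by move=> x_mu lt_zy; apply: IH => //; lia.
have dz := top_disc0 top th_mu (erefl _) az.
have := congr1 (mcoeff z) sumD; rewrite raddf_sum mcoeff0 /=.
rewrite (bigD1_seq th) ?undup_uniq //= big_seq_cond big1 ?addr0 => [/eqP|x /andP[x_mu]].
  by rewrite (negPf az).
apply: contraNeq => axz; apply/eqP.
exact: (disc0_inj x_mu th_mu (top_disc0 top x_mu (erefl _) axz) dz).
Qed.

End UniquenessAtOne.

(** * Lumping *)

Section Lumping.
Variables (K : fieldType) (t : K) (n : nat).
Local Notation P := {mpoly K[n.+1]}.
Implicit Types (z eta lam mu : 'X_{1..n.+1}) (f g : 'X_{1..n.+1} -> P) (i : 'I_n).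

#[local] Opaque swap_var opT opTinv omega omega_inv.

Lemma sum_rearr_swap lam i (Q : pred 'X_{1..n.+1}) f :
  \sum_(z <- rearr lam | Q (swap_comp i z)) f (swap_comp i z)
  = \sum_(z <- rearr lam | Q z) f z.
Proof. by rewrite [RHS](perm_big _ (perm_rearr_swap lam i)) big_map. Qed.

Lemma sum_rearr_rot lam (Q : pred 'X_{1..n.+1}) f :
  \sum_(z <- rearr lam | Q (rot_comp z)) f (rot_comp z)
  = \sum_(z <- rearr lam | Q z) f z.
Proof. by rewrite [RHS](perm_big _ (perm_rearr_rot lam)) big_map. Qed.

(** On each orbit of the swap the sum is [f z] with [T_i f z = t f z], or [f z + T_i f z]; by the
    quadratic relation both are eigenvectors of [T_i] with eigenvalue [t]. *)
Lemma opT_sum_stable lam f i (Q : pred 'X_{1..n.+1}) :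
  exchange_family t lam f -> (forall z, Q (swap_comp i z) = Q z) ->
  opT t i (\sum_(z <- rearr lam | Q z) f z) = t *: \sum_(z <- rearr lam | Q z) f z.
Proof.
move=> fam Qs; rewrite opT_sum scaler_sumr.
(* Chosen so that [T_i f z - t f z] is the difference of [h] at the swap of [z] and at [z]; such
   differences cancel over a set stable under the swap. *)
pose h z := if (z (lpos i) < z (rpos i))%N then f z else t *: f z.
have e z : z \in rearr lam -> opT t i (f z) = t *: f z + (h (swap_comp i z) - h z).
  move=> z_lam; have [gt eq _] := fam z z_lam.
  have [sgt _ _] := fam _ (rearr_swap i z_lam); rewrite /h swap_comp_l swap_comp_r.
  have [lt_rl|lt_lr|ez] := ltngtP (z (rpos i)) (z (lpos i)).
  - by rewrite gt // addrC subrK.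
  - have := sgt i; rewrite swap_comp_l swap_comp_r swap_compK => /(_ lt_lr) <-.
    rewrite opT_quadratic -!mul_mpolyC mpolyCB mpolyC1.
    by move: t%:MP (f _) (opT t i _) => u v w; ring.
  - by rewrite eq // swap_comp_id // subrr addr0.
rewrite big_seq_cond (eq_bigr (fun z => t *: f z + (h (swap_comp i z) - h z))); last first.
  by move=> z /andP[/e].
rewrite -big_seq_cond big_split sumrB /=.
have -> : \sum_(z <- rearr lam | Q z) h (swap_comp i z) = \sum_(z <- rearr lam | Q z) h z.
  by rewrite -[RHS](sum_rearr_swap _ i); apply: eq_bigl => z; rewrite Qs.
by rewrite subrr addr0.
Qed.

Lemma omega_sum_family lam f (Q Q' : pred 'X_{1..n.+1}) :
  exchange_family t lam f -> (forall z, Q' (rot_comp z) = Q z) ->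
  \sum_(z <- rearr lam | Q z) f z = omega 1 (\sum_(z <- rearr lam | Q' z) f z).
Proof.
move=> fam QQ'; rewrite -(sum_rearr_rot lam Q' f) omega_sum [RHS](eq_bigl Q) //.
rewrite big_seq_cond [RHS]big_seq_cond; apply: eq_bigr => z /andP[z_lam _].
by have [_ _] := fam z z_lam.
Qed.

Variables (phi : nat -> nat) (lam mu : 'X_{1..n.+1}).
Hypothesis phi_mono : forall x y : nat, (x <= y)%N -> (phi x <= phi y)%N.
Hypothesis phi_lam : map_parts phi lam = mu.
Local Notation mp := (@map_parts n phi).

Lemma map_parts_swap i z : mp (swap_comp i z) = swap_comp i (mp z).
Proof. by apply/mnmP => k; rewrite !(mnmE, swap_compE). Qed.

Lemma map_parts_rot z : mp (rot_comp z) = rot_comp (mp z).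
Proof. by apply/mnmP => k; rewrite !mnmE. Qed.

Lemma map_parts_rearr z : z \in rearr lam -> mp z \in rearr mu.
Proof.
case/mem_rearr => s zs; apply/mem_rearr; exists s => k.
by rewrite -phi_lam !mnmE zs.
Qed.

Definition lump f eta : P := \sum_(z <- rearr lam | mp z == eta) f z.

(** A strict descent of [eta] lifts to a strict descent of every preimage because [phi] is weakly
    increasing, so the exchange holds term by term. Where [eta] has equal parts the fibre is stable
    under the swap, and [opT_sum_stable] applies. *)
Lemma lump_family f : exchange_family t lam f -> exchange_family t mu (lump f).
Proof.
move=> fam eta eta_mu; split=> [i lt_rl|i e|].
- rewrite /lump opT_sum -(sum_rearr_swap _ i).
  have Qs z : (mp (swap_comp i z) == swap_comp i eta) = (mp z == eta).
    by rewrite map_parts_swap (inj_eq (can_inj (swap_compK i))).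
  rewrite [RHS](eq_bigl _ _ Qs) big_seq_cond [RHS]big_seq_cond; apply: eq_bigr => z.
  case/andP=> z_lam /eqP ez; have [gt _ _] := fam z z_lam; apply: gt.
  move: lt_rl; rewrite -ez !mnmE !ltnNge; apply: contraNN; exact: phi_mono.
- apply: opT_sum_stable => // z; rewrite map_parts_swap.
  by rewrite -{1}(swap_comp_id e) (inj_eq (can_inj (swap_compK i))).
- apply: omega_sum_family => // z.
  by rewrite map_parts_rot (inj_eq (can_inj (@rot_compK n))).
Qed.

Lemma sum_lump f : \sum_(eta <- rearr mu) lump f eta = \sum_(z <- rearr lam) f z.
Proof.
rewrite /lump (exchange_big_dep xpredT) //= big_seq [RHS]big_seq.
apply: eq_bigr => z z_lam; rewrite -big_filter.
have -> : [seq eta <- rearr mu | mp z == eta] = [:: mp z].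
  rewrite -(filter_pred1_uniq (undup_uniq _) (map_parts_rearr z_lam)).
  by apply: eq_filter => eta; rewrite /= eq_sym.
by rewrite big_seq1.
Qed.

Hypothesis t_neq0 : t != 0.
Hypothesis t_inj : injective (fun k => t ^+ k).

Lemma lump_proportional f g : exchange_family t lam f -> exchange_family t mu g ->
  forall eta, eta \in rearr mu ->
    lump f eta * \sum_(z <- rearr mu) g z = g eta * \sum_(z <- rearr lam) f z.
Proof.
move=> fam gam; set Sg := \sum_(z <- rearr mu) g z; set Sf := \sum_(z <- rearr lam) f z.
pose D eta := lump f eta * Sg - g eta * Sf.
have sym kap h i : exchange_family t kap h ->
    swap_var i (\sum_(z <- rearr kap) h z) = \sum_(z <- rearr kap) h z.
  by move=> ham; apply: opT_eq_sym; apply: opT_sum_stable.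
have rot (kap : 'X_{1..n.+1}) h : exchange_family t kap h ->
    omega 1 (\sum_(z <- rearr kap) h z) = \sum_(z <- rearr kap) h z.
  by move=> ham; apply: esym; apply: (omega_sum_family (Q := xpredT) (Q' := xpredT) ham).
have TB i p r : opT t i (p - r) = opT t i p - opT t i r.
  by rewrite -[- r]scaleN1r opTD opTZ scaleN1r.
have Dfam : exchange_family t mu D.
  move=> eta eta_mu; have [gt eq ro] := lump_family fam eta_mu.
  have [gt' eq' ro'] := gam eta eta_mu; split=> [i lt_rl|i e|].
  - by rewrite /D TB !opT_mul_sym ?(sym _ _ _ gam) ?(sym _ _ _ fam) // gt // gt'.
  - rewrite /D TB !opT_mul_sym ?(sym _ _ _ gam) ?(sym _ _ _ fam) // eq // eq' //.
    by rewrite -!scalerAl -scalerBr.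
  - by rewrite /D omegaB !omegaM (rot _ _ gam) (rot _ _ fam) -ro -ro'.
move=> eta eta_mu; apply/eqP; rewrite -subr_eq0; apply/eqP.
apply: (exchange_family_eq0 t_neq0 t_inj Dfam) => //.
(* Both totals become the product of [Sf] and [Sg], so [D] sums to zero. *)
by rewrite /D sumrB -!mulr_suml sum_lump mulrC subrr.
Qed.

End Lumping.

(** * ASEP polynomials at q = 1 *)

Section Specialize.
Variables (F L : fieldType) (phi : {rmorphism {poly F} -> L}).
Hypothesis phi_inj : injective phi.
Variables (q t : L) (t1 : F) (n : nat).
Hypotheses (q_neq0 : q != 0) (t_neq0 : t != 0) (t1_neq0 : t1 != 0).
Hypotheses (spec_q : spec phi q 1) (spec_t : spec phi t t1).
Hypothesis t1_inj : injective (fun k => t1 ^+ k).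
Hypothesis qt_inj : forall a b c d, q ^+ a * t ^- b = q ^+ c * t ^- d -> a = c.
Variable ev : L -> F.
Hypothesis ev_spec : forall r s, spec phi r s -> ev r = s.
Implicit Types (z lam : 'X_{1..n.+1}) (i : 'I_n) (u v k : 'I_n.+1).

#[local] Opaque swap_var opT opTinv omega omega_inv opY.

(** The abstract form of [mat_q1], with [ev] in the place of [at_q1]. *)
Definition mev (p : {mpoly L[n.+1]}) : {mpoly F[n.+1]} :=
  \sum_(m <- msupp p) ev p@_m *: 'X_[m].

Lemma mspec_mev p p' : mspec phi p p' -> p' = mev p.
Proof.
move=> pp; rewrite [LHS](mspec_expand phi_inj pp); apply: eq_bigr => m _.
by rewrite (ev_spec (pp m)).
Qed.

Lemma partition_le lam : is_partition lam ->
  forall i, (lam (rpos i) <= lam (lpos i))%N.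
Proof.
move=> /(sortedP 0%N) h i; have := h i; rewrite size_tuple ltnS ltn_ord => /(_ isT).
by rewrite /geq /= !(mnm_nth 0%N) val_rpos.
Qed.

(** Both compositions have zero discordance with the strictly decreasing [w = (n, ..., 1, 0)], so
    [disc0_inj] identifies them. *)
Lemma sorted_rearr lam z : z \in rearr lam ->
  (forall i, (lam (rpos i) <= lam (lpos i))%N) ->
  (forall i, (z (rpos i) <= z (lpos i))%N) -> z = lam.
Proof.
move=> z_lam lam_le z_le; pose w : 'X_{1..n.+1} := [multinom (n - k)%N | k < n.+1].
have mono x : (forall i, (x (rpos i) <= x (lpos i))%N) ->
    forall u v, (u <= v)%N -> (x v <= x u)%N.
  move=> x_le u v; case: v; elim=> [|v IH] lt_v.
    by rewrite leqn0 => /eqP u0; apply: eq_leq; congr (x _); apply: val_inj.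
  rewrite leq_eqVlt => /orP[/eqP e|]; first by apply: eq_leq; congr (x _); apply: val_inj.
  rewrite ltnS => le_uv; have lt_vn : (v < n)%N by [].
  apply: leq_trans (IH (ltnW lt_v) le_uv).
  have -> : Ordinal lt_v = rpos (Ordinal lt_vn) by apply: val_inj.
  have -> : Ordinal (ltnW lt_v) = lpos (Ordinal lt_vn) by apply: val_inj.
  exact: x_le.
have d0 (x : 'X_{1..n.+1}) : (forall i, (x (rpos i) <= x (lpos i))%N) -> disc x w = 0%N.
  move=> x_le; rewrite /disc big1 // => u _; rewrite big1 // => v _.
  apply/eqP; rewrite eqb0 /dis !mnmE; apply/negP => /andP[lt_vu le_w].
  have lt_uv : (u < v)%N.
    by rewrite ltnNge; apply: contraTN lt_vu => /(mono _ x_le); rewrite -leqNgt.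
  by move: le_w (ltn_ord v); lia.
by apply: (disc0_inj z_lam (rearr_id lam)); apply: d0.
Qed.

Section Family.
Variables (lam : 'X_{1..n.+1}) (Fl : 'X_{1..n.+1} -> {mpoly L[n.+1]}).
Hypothesis lam_part : is_partition lam.
Hypothesis Fl_ASEP : is_ASEP q t lam Fl.

(** Induction on [len]. At an ascent of [z] the polynomial is [T_i] of the one for the shorter,
    swapped composition, and [T_i] preserves both claims. *)
Lemma ASEP_regular z : z \in rearr lam -> mspec phi (Fl z) (mev (Fl z)) /\ lead_at (Fl z) z.
Proof.
suff h : z \in rearr lam ->
    (exists p' : {mpoly F[n.+1]}, mspec phi (Fl z) p') /\ lead_at (Fl z) z.
  by case/h => [[p' pp] lead]; split=> //; rewrite -(mspec_mev pp).
have [[_ Flam1 YFlam] rel] := Fl_ASEP.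
move: {2}(len z) (leqnn (len z)) => l; elim: l z => [|l IH] z le_l z_lam.
all: have [/existsP[i lt_lr]|] := boolP [exists i : 'I_n, (z (lpos i) < z (rpos i))%N].
1,3: have ls : len z = (len (swap_comp i z)).+1 by
  rewrite -[z in LHS](swap_compK i) len_swap // swap_comp_l swap_comp_r.
- by rewrite ls in le_l.
- have s_lam := rearr_swap i z_lam; have [_ gt _ _] := rel _ s_lam.
  have [|[p' pp] lead] := IH (swap_comp i z) _ s_lam; first by move: le_l; rewrite ls.
  have := gt i; rewrite swap_comp_l swap_comp_r swap_compK => /(_ lt_lr) <-.
  split; first by exists (opT t1 i p'); apply: (mspec_opT phi_inj spec_t).
  by rewrite -[z in lead_at _ z](swap_compK i); apply: opT_lead;
     rewrite ?swap_comp_l ?swap_comp_r.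
(* Without ascents [z] is the partition [lam], where [Fl lam] is a normalized eigenvector and hence
   equals the regular one that was constructed. *)
all: rewrite negb_exists => /forallP z_le.
all: have -> : z = lam by apply: sorted_rearr => //;
  [exact: partition_le|by move=> i; rewrite leqNgt].
all: have [e ge] := exists_good phi_inj q_neq0 t_neq0 t1_neq0 spec_q spec_t t1_inj lam.
all: have -> : Fl lam = e by
  apply: (eigvec_lead phi_inj q_neq0 t_neq0 t1_neq0 spec_q spec_t t1_inj qt_inj ge).
all: by have [] := ge.
Qed.

Let f z := mev (Fl z).

Lemma mspec_uniq (p : {mpoly L[n.+1]}) (p1 p2 : {mpoly F[n.+1]}) :
  mspec phi p p1 -> mspec phi p p2 -> p1 = p2.
Proof. by move=> /mspec_mev -> /mspec_mev ->. Qed.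

(** Each relation over the large field is specialized on both sides and the values are compared; the
    factor from the rotation relation specializes to 1. *)
Lemma ASEP_exchange : exchange_family t1 lam f.
Proof.
have [_ rel] := Fl_ASEP; move=> z z_lam; have [_ gt eq ro] := rel z z_lam.
have [sz _] := ASEP_regular z_lam; have sT i := mspec_opT phi_inj spec_t i sz.
split=> [i lt_rl|i e|].
- have [ss _] := ASEP_regular (rearr_swap i z_lam).
  by apply: mspec_uniq (sT i) _; rewrite gt.
- by apply: mspec_uniq (sT i) _; rewrite eq //; apply: mspecZ.
- have [sr _] := ASEP_regular (rearr_rot z_lam).
  have := mspec_uniq (mspecZ (specX (z ord_max) spec_q) sz).
  by rewrite expr1n scale1r; apply; rewrite ro; apply: mspec_omega.
Qed.

Lemma ASEP_sum : mspec phi (macdonaldP lam Fl) (\sum_(z <- rearr lam) f z).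
Proof.
rewrite /macdonaldP big_seq [X in mspec _ _ X]big_seq; apply: mspec_sum => z z_lam.
by have [] := ASEP_regular z_lam.
Qed.

Lemma seq_argmax (T : eqType) (s : seq T) (h : T -> nat) x0 : x0 \in s ->
  exists2 x, x \in s & forall y, y \in s -> (h y <= h x)%N.
Proof.
elim: s x0 => // x s IH x0 _; case: s IH => [|y s] IH.
  by exists x; rewrite ?mem_head // => y; rewrite inE => /eqP ->.
have [w ws wmax] := IH y (mem_head _ _).
have [le_xw|lt_wx] := leqP (h x) (h w).
  exists w; first by rewrite inE ws orbT.
  by move=> v; rewrite inE => /orP[/eqP ->|/wmax].
exists x; rewrite ?mem_head // => v; rewrite inE => /orP[/eqP ->//|/wmax h1].
exact: leq_trans h1 (ltnW lt_wx).
Qed.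

(* Look at the monomial of maximal length in the orbit. *)
Lemma ASEP_sum_neq0 : \sum_(z <- rearr lam) f z != 0.
Proof.
have [w w_lam wmax] := seq_argmax (@len n) (rearr_id lam).
apply/eqP => /(congr1 (mcoeff w)); rewrite raddf_sum mcoeff0 /=.
rewrite (bigD1_seq w) ?undup_uniq //= big_seq_cond big1 ?addr0 => [|z /andP[z_lam zw]].
  have [sw [ew _]] := ASEP_regular w_lam; have := sw w; rewrite ew => /ev_spec <-.
  by rewrite (ev_spec (spec1 phi)) => /eqP; rewrite oner_eq0.
have [sz [_ low]] := ASEP_regular z_lam.
have : (Fl z)@_w = 0.
  apply/eqP; apply: contraT => /low; rewrite eq_sym => /(_ zw).
  by rewrite ltnNge wmax.
by move=> e; have := sz w; rewrite e => /(spec_0 phi_inj).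
Qed.

End Family.
End Specialize.

Theorem theorem4p18 (n : nat) (phi : nat -> nat)
    (phi_mono : forall i j : nat, (i <= j)%N -> (phi i <= phi j)%N)
    (lam mu : 'X_{1..n.+1})
    (lam_part : is_partition lam) (mu_part : is_partition mu)
    (phi_lam : map_parts phi lam = mu)
    (Flam Fmu : 'X_{1..n.+1} -> {mpoly Qqt[n.+1]})
    (Flam_ASEP : is_ASEP qvar tvar lam Flam)
    (Fmu_ASEP : is_ASEP qvar tvar mu Fmu) :
  let G (eta : 'X_{1..n.+1}) : {mpoly Qt[n.+1]} :=
    \sum_(zeta <- rearr lam | map_parts phi zeta == eta) mat_q1 (Flam zeta) in
  let P_lam : {mpoly Qt[n.+1]} := mat_q1 (macdonaldP lam Flam) in
  let P_mu : {mpoly Qt[n.+1]} := mat_q1 (macdonaldP mu Fmu) in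
  let sumG := \sum_(theta <- rearr mu) G theta in
  let sumF := \sum_(theta <- rearr mu) mat_q1 (Fmu theta) in
  (* the specializations at q = 1 and the quotients below are well defined *)
  [/\ forall zeta, zeta \in rearr lam -> mregular_q1 (Flam zeta),
      forall theta, theta \in rearr mu -> mregular_q1 (Fmu theta),
      [/\ P_lam != 0, sumG != 0, sumF != 0 & P_mu != 0]
    & forall eta, eta \in rearr mu ->
      [/\ mquot (G eta) P_lam = mquot (G eta) sumG,
          mquot (G eta) sumG = mquot (mat_q1 (Fmu eta)) sumF
        & mquot (mat_q1 (Fmu eta)) sumF = mquot (mat_q1 (Fmu eta)) P_mu]].
Proof.
move=> G P_lam P_mu sumG sumF.
have ev r s (h : spec fracq r s) : at_q1 r = s by case: (spec_at h).
have reg := ASEP_regular fracq_inj qvar_neq0 tvar_neq0 t1_neq0 spec_q spec_t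
  t1_inj qt_monomial_inj ev.
have fam := ASEP_exchange fracq_inj qvar_neq0 tvar_neq0 t1_neq0 spec_q spec_t
  t1_inj qt_monomial_inj ev.
have tot := ASEP_sum fracq_inj qvar_neq0 tvar_neq0 t1_neq0 spec_q spec_t
  t1_inj qt_monomial_inj ev.
have nz := ASEP_sum_neq0 fracq_inj qvar_neq0 tvar_neq0 t1_neq0 spec_q spec_t
  t1_inj qt_monomial_inj ev.
have eP (kap : 'X_{1..n.+1}) Fk : is_partition kap -> is_ASEP qvar tvar kap Fk ->
    mat_q1 (macdonaldP kap Fk) = \sum_(z <- rearr kap) mat_q1 (Fk z).
  by move=> hk hF; case: (mspec_at (tot n kap Fk hk hF)).
have esumF : sumF = P_mu by rewrite /P_mu eP.
have esumG : sumG = P_lam.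
  by rewrite /P_lam eP //; apply: (sum_lump phi_lam (fun z => mat_q1 (Flam z))).
have Plam0 : P_lam != 0 by rewrite /P_lam eP //; apply: nz.
have Pmu0 : P_mu != 0 by rewrite /P_mu eP //; apply: nz.
split.
- by move=> z z_lam; have [/mspec_at[]] := reg n lam Flam lam_part Flam_ASEP z z_lam.
- by move=> z z_mu; have [/mspec_at[]] := reg n mu Fmu mu_part Fmu_ASEP z z_mu.
- by rewrite esumG esumF.
move=> eta eta_mu; rewrite esumG esumF; split=> //.
(* Cross-multiplication, legitimate since both denominators are nonzero, turns the middle equality
   into a polynomial identity. *)
rewrite /mquot; apply/eqP; rewrite eqr_div ?tofrac_eq0 // -!tofracM tofrac_eq.
apply/eqP; rewrite /P_lam /P_mu !eP //.
exact: (lump_proportional phi_mono phi_lam t1_neq0 t1_inj (fam n lam Flam lam_part Flam_ASEP)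
         (fam n mu Fmu mu_part Fmu_ASEP) eta_mu).
Qed.
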